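(* Let $V=V_1+V_2$ be an orthogonal sum with $V_1=\mathbb R^{m,m}$, $m\ge1$, and $V_2=\mathbb R^{k,0}$ or $\mathbb R^{0,k}$, $k\ge1$. Let $S_1,S_2$ and $S=S_1\otimes S_2$ be the corresponding spinor modules (see context), let $\mathcal B_2,\mathcal B$ be the spaces of $\mathfrak{so}(V_2)$-invariant bilinear forms on $S_2$, resp. $\mathfrak{so}(V)$-invariant bilinear forms on $S$, and let $\mathcal C_2,\mathcal C$ be the Schur algebras of $S_2$, resp. $S$. There exist natural isomorphisms $\phi:\mathcal B_2\to\mathcal B$ of vector spaces and $\psi:\mathcal C_2\to\mathcal C$ of algebras mapping admissible elements onto admissible elements. Namely, they are the linear maps determined as follows: for admissible $\beta_2\in\mathcal B_2$, $\phi(\beta_2)=\beta_1\otimes\beta_2$, where $\beta_1\in\{f,f_E\}$ is the form on $S_1$ with $\tau(\beta_2)=\iota(\beta_1)\tau(\beta_1)$; for admissible $A_2\in\mathcal C_2$, $\psi(A_2)=A_1\otimes A_2$, where $A_1\in\{\mathrm{Id},E\}$ is the endomorphism of $S_1$ with $\tau(A_2)=\iota(A_1)\tau(A_1)$. Under these maps the fundamental invariants transform according to $$\tau(\phi(\beta_2))=\tau(\beta_1)=\iota(\beta_1)\tau(\beta_2),\quad \sigma(\phi(\beta_2))=\sigma(\beta_1)\sigma(\beta_2),\quad \iota(\phi(\beta_2))=\iota(\beta_1)\iota(\beta_2),$$ $$\tau(\psi(A_2))=\tau(A_1)=\iota(A_1)\tau(A_2),\quad \sigma(\psi(A_2))=\sigma(A_1)\sigma(A_2),\quad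 \iota(\psi(A_2))=\iota(A_1)\iota(A_2),$$ the formulas for $\iota$ applying when $S_2$ (equivalently $S$) is reducible over the even Clifford algebra. In particular, if $m\equiv0\pmod 4$, then $\phi$ and $\psi$ preserve the fundamental invariants ((4,4)-periodicity).
   Context: Clifford algebras use $v^2=-\langle v,v\rangle$. A spinor module of a pseudo-Euclidean space $W$ is an irreducible real $C\ell(W)$-module; $\rho$ denotes Clifford multiplication. If it is reducible over $C\ell^0(W)$ it is written $S^++S^-$ with irreducible $C\ell^0(W)$-submodules and $S^-=C\ell^1(W)S^+$. The Schur algebra is the algebra of $\mathfrak{so}(W)$-invariant (i.e. $C\ell^0(W)$-commuting) endomorphisms. Model of $S_1$: write $\mathbb R^{m,m}=U+U^*$ with complementary isotropic subspaces, $U^*$ dual to $U$ by $u^*(u)=\langle u,u^*\rangle$; $S_1=\wedge U$ with $\rho(u)s=u\wedge s$, $\rho(u^* )s=-2\,u^*\angle s$ ($\angle$ = interior multiplication), $S_1^+=\wedge^{ev}U$, $S_1^-=\wedge^{odd}U$, $E|S_1^\pm=\pm\mathrm{Id}$. Fix $0\neq vol\in\wedge^mU$; $f(\wedge^iU,\wedge^jU)=0$ if $i+j\ne m$ and $f(s,t)\,vol=(-1)^{i(i+1)/2}s\wedge t$ for $s\in\wedge^iU$, $t\in\wedge^{m-i}U$; $f_E=f(E\cdot,\cdot)$. $S=S_1\otimes S_2$ is an irreducible $C\ell(V)$-module by $(v_1+v_2)(s_1\otimes s_2)=v_1s_1\otimes s_2+(-1)^{\deg s_1}s_1\otimes v_2s_2$,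 with $\deg=0$ on $S_1^+$ and $1$ on $S_1^-$; if $S_2=S_2^++S_2^-$ is reducible then $S^+=S_1^+\otimes S_2^++S_1^-\otimes S_2^-$, $S^-=S_1^+\otimes S_2^-+S_1^-\otimes S_2^+$. A nonzero bilinear form $\beta$ on a spinor module $S$ is admissible if: (1) for some $\tau(\beta)=\pm1$, $\beta(\rho(v)s,t)=\tau(\beta)\beta(s,\rho(v)t)$ for all vectors $v$; (2) $\beta$ is symmetric ($\sigma(\beta)=+1$) or skew symmetric ($\sigma(\beta)=-1$); (3) if $S=S^++S^-$ is reducible, $S^\pm$ are mutually orthogonal ($\iota(\beta)=+1$) or both isotropic ($\iota(\beta)=-1$). For an admissible form $\beta$, a nonzero endomorphism $A$ is $\beta$-admissible if: (1) $A\rho(v)=\tau(A)\rho(v)A$ for all $v$, some $\tau(A)=\pm1$; (2) $\beta(As,t)=\sigma_\beta(A)\beta(s,At)$ for some $\sigma_\beta(A)=\pm1$; (3) if $S=S^++S^-$, then $AS^\pm\subset S^\pm$ ($\iota(A)=+1$) or $AS^\pm\subset S^\mp$ ($\iota(A)=-1$). On $S_2$ let $h_2$ be the positive definite scalar product invariant under Clifford multiplication by unit vectors (unique up to scaling; it is admissible); on $S_1$ let $h_1\in\{f,f_E\}$ be the form with $\tau(h_2)=\iota(h_1)\tau(h_1)$; on $S$ let $h=h_1\otimes h_2$. An endomorphism of $S_2$, $S_1$, $S$ is called admissible, with symmetry $\sigma$, if it is $h_2$-, $h_1$-, $h$-admissible, with $\sigma=\sigma_{h_2},\sigma_{h_1},\sigma_h$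 respectively. The fundamental invariants are $\tau,\sigma$ and (when defined) $\iota$. *)

(* Defs.v *)
From HB Require Import structures.
From mathcomp Require Import all_boot all_order all_algebra ring.

Set Implicit Arguments.
Unset Strict Implicit.
Unset Printing Implicit Defensive.

Import Order.TTheory GRing.Theory Num.Theory.
Local Open Scope ring_scope.

Section Bilinear.
Variable R : realFieldType.

Definition bilinfun (U V W : vectType R) (b : U -> V -> W) :
  'Hom(U, 'Hom(V, W)) := linfun (fun u => linfun (b u)).

Lemma linfunE (U V : vectType R) (a : U -> V) : linear a -> linfun a =1 a.
Proof.
move=> la.
pose M := GRing.isLinear.Build R U V *:%R a la.
pose F : {linear U -> V} := HB.pack a M.
exact: (lfunE F).
Qed.

Lemma bilinfunE (U V W : vectType R) (b : U -> V -> W) :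
  (forall u, linear (b u)) -> (forall v, linear (b^~ v)) ->
  forall u v, bilinfun b u v = b u v.
Proof.
move=> lr ll u v; rewrite linfunE ?linfunE //.
move=> c x y; apply/lfunP => z.
by rewrite add_lfunE scale_lfunE !linfunE //; exact: ll.
Qed.

Definition bilform (S : vectType R) := 'Hom(S, 'Hom(S, R^o)).

End Bilinear.

(* The tensor product of the space with basis I and T is {ffun I -> T}:     *)
(* x is the element \sum_i e_i (x) x i.                                      *)
Section Tensor.
Variables (R : realFieldType) (I : finType) (T : vectType R).
Local Notation S1 := {ffun I -> R^o}.
Local Notation S := {ffun I -> T}.

Definition ffbasis (i : I) : S1 := [ffun j => (i == j)%:R].

Definition tens (s : S1) (t : T) : S := [ffun i => s i *: t].

Definition tens_end (A : 'End(S1)) (B : 'End(T)) : 'End(S) :=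
  linfun (fun x : S => \sum_i tens (A (ffbasis i)) (B (x i))).

Definition tens_form (b1 : bilform S1) (b2 : bilform T) : bilform S :=
  bilinfun (fun x y : S =>
    \sum_i \sum_j b1 (ffbasis i) (ffbasis j) * b2 (x i) (y j) : R^o).

Definition tens_space (U1 : {vspace S1}) (U2 : {vspace T}) : {vspace S} :=
  <<[seq tens u1 u2 | u1 <- vbasis U1, u2 <- vbasis U2]>>%VS.

Lemma tens_linearl t : linear (tens^~ t).
Proof.
by move=> c x y; apply/ffunP=> i; rewrite !ffunE scalerDl scalerA.
Qed.

Lemma tens_linearr s : linear (tens s).
Proof.
by move=> c x y; apply/ffunP=> i; rewrite !ffunE scalerDr !scalerA mulrC.
Qed.

Lemma ffbasis_sum (s : S1) : s = \sum_i s i *: ffbasis i.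
Proof.
apply/ffunP=> j; rewrite sum_ffunE (bigD1 j) //= big1 => [|i ij].
  by rewrite !ffunE eqxx addr0 [RHS]mulr1.
by rewrite !ffunE (negPf ij) [LHS]mulr0.
Qed.

Lemma tens_end_linear (A : 'End(S1)) (B : 'End(T)) :
  linear (fun x : S => \sum_i tens (A (ffbasis i)) (B (x i))).
Proof.
move=> c x y; rewrite scaler_sumr -big_split; apply: eq_bigr => i _ /=.
by rewrite !ffunE linearP tens_linearr.
Qed.

Lemma tens_endE A B s t : tens_end A B (tens s t) = tens (A s) (B t).
Proof.
rewrite linfunE; last exact: tens_end_linear.
rewrite [in RHS](ffbasis_sum s) linear_sum /=.
apply/ffunP=> j; rewrite !sum_ffunE !ffunE sum_ffunE scaler_suml.
apply: eq_bigr => i _.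
by rewrite !ffunE !linearZ !ffunE /= scalerA.
Qed.

Lemma tens_formE b1 b2 s t s' t' :
  tens_form b1 b2 (tens s t) (tens s' t') = b1 s s' * b2 t t'.
Proof.
rewrite bilinfunE.
- rewrite [in RHS](ffbasis_sum s) linear_sum sum_lfunE mulr_suml.
  apply: eq_bigr => i _.
  rewrite [in RHS](ffbasis_sum s') linear_sum mulr_suml; apply: eq_bigr => j _.
  rewrite !ffunE !linearZ /= !scale_lfunE !linearZ /GRing.scale /= !mulrA.
  by congr (_ * _); rewrite -mulrA mulrC -mulrA.
- move=> x c y y'; rewrite scaler_sumr -big_split; apply: eq_bigr => i _ /=.
  rewrite scaler_sumr -big_split; apply: eq_bigr => j _ /=.
  by rewrite !ffunE linearP mulrDr /GRing.scale /= !mulrA (mulrC c).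
- move=> y c x x'; rewrite scaler_sumr -big_split; apply: eq_bigr => i _ /=.
  rewrite scaler_sumr -big_split; apply: eq_bigr => j _ /=.
  rewrite !ffunE linearP add_lfunE scale_lfunE mulrDr /GRing.scale /= !mulrA.
  by rewrite (mulrC c).
Qed.

Lemma tens_basis_sum (x : S) : x = \sum_i tens (ffbasis i) (x i).
Proof.
apply/ffunP=> j; rewrite sum_ffunE (bigD1 j) //= big1 => [|i ij].
  by rewrite !ffunE eqxx addr0 scale1r.
by rewrite !ffunE (negPf ij) scale0r.
Qed.

Lemma tens_lfunP (U : vectType R) (A B : 'Hom(S, U)) :
  (forall s t, A (tens s t) = B (tens s t)) -> A = B.
Proof.
move=> eqAB; apply/lfunP=> x; rewrite (tens_basis_sum x) !linear_sum.
by apply: eq_bigr => i _; apply: eqAB.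
Qed.

End Tensor.

(* The exterior algebra of U = R^m: s C is the coefficient in s of           *)
(* e_C = e_(c_1) ^ ... ^ e_(c_p), where C = {c_1 < ... < c_p}.               *)
Section Exterior.
Variables (R : realFieldType) (m : nat).

Definition ext := {ffun {set 'I_m} -> R^o}.
HB.instance Definition _ := Vector.on ext.

Implicit Types (A C : {set 'I_m}) (u a : 'rV[R]_m) (s t : ext).

(* The number of transpositions that sort e_A ^ e_B. *)
Definition inversions A (B : {set 'I_m}) : nat :=
  #|[set p in setX A B | (p.2 < p.1)%N]|.

Definition ext_deg (i : nat) s : Prop := forall A, #|A| != i -> s A = 0.

Definition wedge s t : ext :=
  [ffun C : {set 'I_m} => \sum_(A in powerset C)
     (-1) ^+ inversions A (C :\: A) * s A * t (C :\: A)].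

Definition ext_vec u : ext := \sum_i u 0 i *: ffbasis R [set i].

(* Contraction with the vector of U^* with coordinates a in the dual basis:  *)
(* e_i^* maps e_(i |: C) to (-1)^(number of elements of C below i) e_C.      *)
Definition interior a s : ext :=
  [ffun C : {set 'I_m} =>
     \sum_(i | i \notin C) (-1) ^+ inversions [set i] C * a 0 i * s (i |: C)].

Definition ext_rho_fun (v : 'rV[R]_m * 'rV[R]_m) s : ext :=
  wedge (ext_vec v.1) s - 2 *: interior v.2 s.

Definition ext_rho : 'Hom(('rV[R]_m * 'rV[R]_m)%type, 'End(ext)) :=
  bilinfun ext_rho_fun.

Definition ext_even : {vspace ext} :=
  <<[seq ffbasis R A | A <- enum {set 'I_m} & ~~ odd #|A|]>>%VS.

Definition ext_odd : {vspace ext} :=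
  <<[seq ffbasis R A | A <- enum {set 'I_m} & odd #|A|]>>%VS.

Definition ext_E_fun s : ext := [ffun A : {set 'I_m} => (-1) ^+ #|A| * s A].

Definition ext_E : 'End(ext) := linfun ext_E_fun.

(* f(s, t) vol = (-1)^(i(i+1)/2) s ^ t for s of degree i and t of degree     *)
(* m - i, and f = 0 in other degrees: see ext_form_vol and ext_form_eq0.     *)
Definition ext_twist s : ext :=
  [ffun A : {set 'I_m} => (-1) ^+ (#|A| * #|A|.+1)./2 * s A].

Definition ext_form_fun (vol : ext) s t : R^o :=
  wedge (ext_twist s) t [set: 'I_m] / vol [set: 'I_m].

Definition ext_form (vol : ext) : bilform ext := bilinfun (ext_form_fun vol).

(* f_E = f(E -, -) *)
Definition ext_form_E (vol : ext) : bilform ext := (ext_form vol \o ext_E)%VF.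

Lemma wedge_linearl t : linear (wedge^~ t).
Proof.
move=> c x y; apply/ffunP=> C; rewrite !ffunE.
rewrite scaler_sumr -big_split; apply: eq_bigr => A _ /=.
rewrite !ffunE /GRing.scale /=; ring.
Qed.

Lemma wedge_linearr s : linear (wedge s).
Proof.
move=> c x y; apply/ffunP=> C; rewrite !ffunE.
rewrite scaler_sumr -big_split; apply: eq_bigr => A _ /=.
rewrite !ffunE /GRing.scale /=; ring.
Qed.

Lemma interior_linearl s : linear (interior^~ s).
Proof.
move=> c x y; apply/ffunP=> C; rewrite !ffunE.
rewrite scaler_sumr -big_split; apply: eq_bigr => i _ /=.
rewrite !mxE /GRing.scale /=; ring.
Qed.

Lemma interior_linearr a : linear (interior a).
Proof.
move=> c x y; apply/ffunP=> C; rewrite !ffunE.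
rewrite scaler_sumr -big_split; apply: eq_bigr => i _ /=.
rewrite !ffunE /GRing.scale /=; ring.
Qed.

Lemma ext_vec_linear : linear ext_vec.
Proof.
move=> c x y; rewrite /ext_vec scaler_sumr -big_split; apply: eq_bigr => i _.
by rewrite !mxE scalerDl scalerA.
Qed.

Lemma ext_rhoE v s : ext_rho v s = ext_rho_fun v s.
Proof.
apply: bilinfunE => [{s v}v c s t|{s v}s c v w]; rewrite /ext_rho_fun /=.
  rewrite wedge_linearr interior_linearr scalerBr addrACA; congr (_ + _).
  by rewrite scalerDr opprD !scalerA mulrC.
rewrite ext_vec_linear wedge_linearl interior_linearl scalerBr addrACA.
by congr (_ + _); rewrite scalerDr opprD !scalerA mulrC.
Qed.

Lemma ext_EE s : ext_E s = ext_E_fun s.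
Proof.
apply: linfunE => c x y; apply/ffunP=> A; rewrite !ffunE /GRing.scale /=.
ring.
Qed.

Lemma ext_formE vol s t : ext_form vol s t = ext_form_fun vol s t.
Proof.
apply: bilinfunE => [{s t}s c x y|{s t}t c x y]; rewrite /ext_form_fun.
  rewrite wedge_linearr !ffunE /GRing.scale /=; ring.
have -> : ext_twist (c *: x + y) = c *: ext_twist x + ext_twist y.
  apply/ffunP=> A; rewrite !ffunE /GRing.scale /=; ring.
rewrite wedge_linearl !ffunE /GRing.scale /=; ring.
Qed.

Lemma wedge_deg i j s t C :
  ext_deg i s -> ext_deg j t -> #|C| != (i + j)%N -> wedge s t C = 0.
Proof.
move=> si tj Cij; rewrite ffunE big1 // => A; rewrite inE => sAC.
have [Ai|/si->] := eqVneq #|A| i; last by rewrite mulr0 mul0r.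
rewrite tj ?mulr0 //; apply: contra Cij => /eqP <-.
by rewrite cardsDS // -Ai subnKC // subset_leq_card.
Qed.

Lemma ext_twist_deg i s : ext_deg i s ->
  ext_twist s = (-1) ^+ (i * i.+1)./2 *: s.
Proof.
move=> si; apply/ffunP=> A; rewrite !ffunE.
by have [->|/si->] := eqVneq #|A| i; rewrite // scaler0 mulr0.
Qed.

Lemma wedgeZl c s t : wedge (c *: s) t = c *: wedge s t.
Proof.
apply/ffunP=> C; rewrite !ffunE scaler_sumr; apply: eq_bigr => A _.
rewrite !ffunE /GRing.scale /=; ring.
Qed.

Lemma vol_top vol : ext_deg m vol -> vol != 0 -> vol [set: 'I_m] != 0.
Proof.
move=> volm; apply: contra => /eqP vol0; apply/eqP/ffunP=> A; rewrite ffunE.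
have [Am|/volm //] := eqVneq #|A| m.
suff -> : A = [set: 'I_m] by [].
by apply/eqP; rewrite eqEcard subsetT cardsT card_ord Am leqnn.
Qed.

Lemma ext_form_vol vol i j s t :
  ext_deg m vol -> vol != 0 -> ext_deg i s -> ext_deg j t -> (i + j = m)%N ->
  ext_form vol s t *: vol = (-1) ^+ (i * i.+1)./2 *: wedge s t.
Proof.
move=> volm vol0 si tj ijm; apply/ffunP=> C.
have [Cm|Cm] := eqVneq #|C| m; last first.
  by rewrite ffunE [RHS]ffunE volm // (wedge_deg si tj) ?ijm // !scaler0.
have {Cm}-> : C = [set: 'I_m].
  by apply/eqP; rewrite eqEcard subsetT cardsT card_ord Cm leqnn.
rewrite [LHS]ffunE [RHS]ffunE ext_formE /ext_form_fun (ext_twist_deg si).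
by rewrite wedgeZl ffunE /GRing.scale /= divfK // vol_top.
Qed.

Lemma ext_form_eq0 vol i j s t :
  ext_deg i s -> ext_deg j t -> (i + j)%N != m -> ext_form vol s t = 0.
Proof.
move=> si tj ijm; rewrite ext_formE /ext_form_fun (ext_twist_deg si) wedgeZl.
rewrite ffunE (wedge_deg si tj) ?cardsT ?card_ord 1?eq_sym //.
by rewrite scaler0 mul0r.
Qed.

Lemma wedge_basis A s C : wedge (ffbasis R A) s C =
  if A \subset C then (-1) ^+ inversions A (C :\: A) * s (C :\: A) else 0.
Proof.
rewrite ffunE; case: ifPn => sAC.
  rewrite (bigD1 A) ?inE //= big1 => [|B /andP[_ BA]].
    by rewrite ffunE eqxx addr0 mulr1.
  by rewrite ffunE eq_sym (negPf BA) mulr0 mul0r.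
rewrite big1 // => B; rewrite inE => sBC; rewrite ffunE.
by case: eqVneq sBC => [<-|]; rewrite ?(negPf sAC) // mulr0 mul0r.
Qed.

Lemma wedge_vecE u s C : wedge (ext_vec u) s C =
  \sum_(i in C) (-1) ^+ inversions [set i] (C :\ i) * u 0 i * s (C :\ i).
Proof.
have -> : wedge (ext_vec u) s = \sum_i u 0 i *: wedge (ffbasis R [set i]) s.
  rewrite /ext_vec.
  elim/big_rec2: _ => [|i x y _ <-]; last by rewrite wedge_linearl.
  by have := wedgeZl 0 0 s; rewrite !scale0r.
rewrite sum_ffunE [RHS]big_mkcond; apply: eq_bigr => i _.
rewrite ffunE wedge_basis sub1set; case: ifP => _; last by rewrite scaler0.
rewrite /GRing.scale /=; ring.
Qed.

Lemma inversionsU1 i j C : j \notin C ->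
  inversions [set i] (j |: C) = ((j < i) + inversions [set i] C)%N.
Proof.
have inv1 D : inversions [set i] D = #|[set b in D | (b < i)%N]|.
  rewrite -(card_imset _ (can_inj (fun b : 'I_m => erefl (i, b).2))).
  apply: eq_card => -[a b]; rewrite !inE /=.
  apply/idP/imsetP => [/andP[/andP[/eqP-> bD] bi]|[c]].
    by exists b; rewrite ?inE ?bD.
  by rewrite inE => /andP[cD ci] [-> ->]; rewrite eqxx cD.
move=> jC; rewrite !inv1; have [ji|ij] := ltnP j i.
  rewrite -(_ : j |: [set b in C | (b < i)%N] = [set b in j |: C | (b < i)%N]).
    by rewrite cardsU1 inE (negPf jC).
  by apply/setP=> b; rewrite !inE; case: eqVneq => // ->; rewrite ji.
apply: eq_card => b; rewrite !inE; case: eqVneq => // ->.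
by rewrite ltnNge ij (negPf jC).
Qed.

Lemma sum_antisym (P : rel 'I_m) (F : 'I_m -> 'I_m -> R) :
  symmetric P -> (forall i j, P i j -> F i j = - F j i) ->
  \sum_i \sum_(j | P i j) F i j = 0.
Proof.
move=> Ps Fa; set X := LHS.
suff : X = - X by move/eqP; rewrite -addr_eq0 -mulr2n mulrn_eq0 => /eqP.
rewrite {1}/X (exchange_big_dep predT) //= -sumrN; apply: eq_bigr => i _.
rewrite -sumrN; apply: eq_big => [j|j]; first by rewrite Ps.
exact: Fa.
Qed.

Lemma sign_lt (i j : 'I_m) : i != j ->
  (-1) ^+ (i < j)%N = - (-1) ^+ (j < i)%N :> R.
Proof.
rewrite -val_eqE /=; case: ltngtP => // _ _; rewrite ?expr0 ?expr1 ?opprK //.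
Qed.

Lemma wedge_vec_sq u s : wedge (ext_vec u) (wedge (ext_vec u) s) = 0.
Proof.
apply/ffunP=> C; rewrite wedge_vecE ffunE.
pose F i j := (-1) ^+ inversions [set i] (C :\ i) * u 0 i *
  ((-1) ^+ inversions [set j] (C :\ i :\ j) * u 0 j * s (C :\ i :\ j)).
rewrite -[RHS](@sum_antisym (fun i j => [&& i != j, i \in C & j \in C]) F).
- rewrite big_mkcond; apply: eq_bigr => i _.
  case: ifP => iC; last by rewrite big1 // => j; rewrite andbF.
  rewrite wedge_vecE mulr_sumr; apply: eq_bigl => j.
  by rewrite !inE /= eq_sym.
- by move=> i j; rewrite eq_sym [(i \in C) && _]andbC.
move=> i j /and3P[ij iC jC]; rewrite /F.
have DE : C :\ j :\ i = C :\ i :\ j.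
  by apply/setP=> b; rewrite !inE andbCA.
have Ei : inversions [set i] (C :\ i) =
    ((j < i) + inversions [set i] (C :\ i :\ j))%N.
  by rewrite -inversionsU1 ?setD1K // !inE ?eqxx // eq_sym ij.
have Ej : inversions [set j] (C :\ j) =
    ((i < j) + inversions [set j] (C :\ i :\ j))%N.
  by rewrite -DE -inversionsU1 ?setD1K // !inE ?eqxx // ij.
rewrite Ei Ej DE !exprD (sign_lt ij); ring.
Qed.

Lemma interior_sq a s : interior a (interior a s) = 0.
Proof.
apply/ffunP=> C; rewrite !ffunE.
pose F i j := (-1) ^+ inversions [set i] C * a 0 i *
  ((-1) ^+ inversions [set j] (i |: C) * a 0 j * s (j |: (i |: C))).
rewrite -[RHS](@sum_antisym
  (fun i j => [&& i != j, i \notin C & j \notin C]) F).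
- rewrite big_mkcond; apply: eq_bigr => i _.
  case: ifP => iC; last by rewrite big1 // => j; rewrite andbF.
  rewrite ffunE mulr_sumr; apply: eq_bigl => j.
  by rewrite !inE /= negb_or eq_sym.
- by move=> i j; rewrite eq_sym [(i \notin C) && _]andbC.
move=> i j /and3P[ij iC jC]; rewrite /F !inversionsU1 // !exprD setUCA.
by rewrite (sign_lt ij); ring.
Qed.

Lemma sign_cancel n (x y z : R) :
  (-1) ^+ n * x * ((-1) ^+ n * y * z) = x * y * z.
Proof.
transitivity ((-1) ^+ n ^+ 2 * (x * y * z)); first by ring.
by rewrite sqrr_sign mul1r.
Qed.

Lemma wedge_interior u a s :
  wedge (ext_vec u) (interior a s) + interior a (wedge (ext_vec u) s) =
  (\sum_i u 0 i * a 0 i) *: s.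
Proof.
apply/ffunP=> C; rewrite ffunE wedge_vecE.
pose W i j := (-1) ^+ inversions [set i] (C :\ i) * u 0 i *
  ((-1) ^+ inversions [set j] (C :\ i) * a 0 j * s (j |: (C :\ i))).
pose K j i := (-1) ^+ inversions [set j] C * a 0 j *
  ((-1) ^+ inversions [set i] ((j |: C) :\ i) * u 0 i * s ((j |: C) :\ i)).
rewrite (eq_bigr (fun i => u 0 i * a 0 i * s C +
  \sum_(j | j \notin C) W i j)) => [|i iC]; last first.
  rewrite ffunE (bigD1 i) ?inE ?eqxx //= mulrDr mulr_sumr; congr (_ + _).
    by rewrite setD1K // sign_cancel.
  apply: eq_bigl => j; rewrite !inE.
  by case: eqVneq => [->|]; rewrite ?iC ?andbT ?andbF.
rewrite ffunE [X in _ + X = _](eq_bigr (fun j => u 0 j * a 0 j * s C +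
  \sum_(i in C) K j i)) => [|j jC]; last first.
  rewrite wedge_vecE (bigD1 j) ?setU11 //= mulrDr mulr_sumr; congr (_ + _).
    by rewrite setU1K // sign_cancel; ring.
  apply: eq_bigl => i; rewrite !inE.
  by case: eqVneq => [->|]; rewrite ?(negPf jC) ?andbT ?andbF.
rewrite !big_split /= addrACA -[RHS]addr0; congr (_ + _).
  rewrite -!mulr_suml -mulrDl [in RHS](bigID (mem C)) /=.
  by rewrite [RHS]ffunE.
rewrite [X in _ + X = _](exchange_big_dep (mem C)) //= -big_split big1 // => i iC /=.
rewrite [X in _ + X](eq_bigl (fun j => j \notin C)) => [|j]; last first.
  by rewrite iC andbT.
rewrite -big_split big1 // => j jC /=; rewrite /W /K.
have ij : i != j by apply: contra jC => /eqP <-.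
have DE : (j |: C) :\ i = j |: (C :\ i).
  by apply/setP=> b; rewrite !inE; case: eqVneq => // ->; rewrite (negPf ij).
have jCi : j \notin C :\ i by rewrite !inE negb_and jC orbT.
have EC : inversions [set j] C = ((i < j) + inversions [set j] (C :\ i))%N.
  by rewrite -inversionsU1 ?setD1K // !inE eqxx.
rewrite DE EC inversionsU1 // !exprD (sign_lt ij).
by case: (j < i)%N; rewrite ?expr0 ?expr1; ring.
Qed.

Lemma ext_rho_sq v s : ext_rho v (ext_rho v s) =
  - (2 * \sum_i v.1 0 i * v.2 0 i) *: s.
Proof.
have sE : ext_rho_fun v s = -2 *: interior v.2 s + wedge (ext_vec v.1) s.
  by rewrite addrC scaleNr.
rewrite !ext_rhoE sE /ext_rho_fun wedge_linearr interior_linearr.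
rewrite wedge_vec_sq interior_sq scaler0 addr0 add0r scaleNr -opprD.
by rewrite -scalerDr wedge_interior scalerA scaleNr.
Qed.

Lemma ext_E_sq s : ext_E (ext_E s) = s.
Proof.
rewrite !ext_EE; apply/ffunP=> A.
by rewrite !ffunE mulrA -expr2 sqrr_sign mul1r.
Qed.

Lemma ext_E_rho v s : ext_E (ext_rho v s) = - ext_rho v (ext_E s).
Proof.
rewrite !ext_EE !ext_rhoE /ext_rho_fun; apply/ffunP=> A.
have subA (x y : ext) : (x - 2 *: y) A = x A - 2 * y A by rewrite !ffunE.
rewrite [LHS]ffunE [RHS]ffunE !subA !wedge_vecE ![interior _ _ _]ffunE.
rewrite opprD opprK mulrBr; congr (_ + _).
  rewrite mulr_sumr -sumrN; apply: eq_bigr => i iA.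
  rewrite ffunE (cardsD1 i A) iA exprS; ring.
rewrite mulrCA -mulrN; congr (_ * _).
rewrite mulr_sumr -sumrN; apply: eq_bigr => i iA.
rewrite ffunE (cardsU1 i A) iA exprS; ring.
Qed.

End Exterior.

From mathcomp Require Import boolp classical_sets functions reals.
Local Open Scope classical_set_scope.
Local Open Scope ring_scope.

Section PseudoEuclidean.
Variable R : realType.

(* R^{m,m} = U + U^*, a pair being (vector of U, coordinates of a covector). *)
Definition neutral_form m (v w : 'rV[R]_m * 'rV[R]_m) : R :=
  \sum_i (v.1 0 i * w.2 0 i + w.1 0 i * v.2 0 i).

(* R^{k,0} if neg = false and R^{0,k} if neg = true. *)
Definition definite_form k (neg : bool) (x y : 'rV[R]_k) : R :=
  (-1) ^+ neg * \sum_i x 0 i * y 0 i.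

Definition orthogonal_sum (W1 W2 : Type) (g1 : W1 -> W1 -> R)
    (g2 : W2 -> W2 -> R) (v w : W1 * W2) : R :=
  g1 v.1 w.1 + g2 v.2 w.2.

End PseudoEuclidean.

(* By the universal property of Cl(W), a Cl(W)-module structure on S is a    *)
(* linear map rho : W -> End(S) with rho(v)^2 = - <v,v>; Cl^0(W) and Cl^1(W) *)
(* are spanned by the products of an even, resp. odd, number of vectors.     *)
Section CliffordModules.
Variables (R : realType) (W S : vectType R).
Implicit Types (g : W -> W -> R) (rho : 'Hom(W, 'End(S))).
Implicit Types (M N Sp Sm : {vspace S}).

Definition clifford_module g rho : Prop :=
  forall v, (rho v \o rho v)%VF = - g v v *: \1%VF.

Definition clifford_word rho (vs : seq W) : 'End(S) :=
  foldr (fun v A => (rho v \o A)%VF) \1%VF vs.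

Definition cl_stable rho M : Prop :=
  forall vs, (clifford_word rho vs @: M <= M)%VS.

Definition cl0_stable rho M : Prop :=
  forall vs, ~~ odd (size vs) -> (clifford_word rho vs @: M <= M)%VS.

Definition irreducible (stable : {vspace S} -> Prop) M : Prop :=
  [/\ M != 0%VS, stable M &
      forall N, (N <= M)%VS -> stable N -> N = 0%VS \/ N = M].

Definition spinor_module g rho : Prop :=
  clifford_module g rho /\ irreducible (cl_stable rho) fullv.

Definition cl0_reducible rho : Prop := ~ irreducible (cl0_stable rho) fullv.

(* Sm = Cl^1(W) Sp, the span of the images of Sp under odd products. *)
Definition cl1_image rho Sp Sm : Prop :=
  forall N, (Sm <= N)%VS <->
    (forall vs, odd (size vs) -> (clifford_word rho vs @: Sp <= N)%VS).

Definition semispinors rho Sp Sm : Prop :=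
  [/\ irreducible (cl0_stable rho) Sp, irreducible (cl0_stable rho) Sm,
      cl1_image rho Sp Sm, (Sp + Sm)%VS = fullv & (Sp :&: Sm)%VS = 0%VS].

(* so(W) acts on S through spin(W), the span in Cl(W) of the [u, v]. *)
Definition spin_bracket rho (u v : W) : 'End(S) :=
  (rho u \o rho v)%VF - (rho v \o rho u)%VF.

Definition inv_forms rho : set (bilform S) :=
  [set b : bilform S | forall u v s t,
     b (spin_bracket rho u v s) t + b s (spin_bracket rho u v t) = 0].

Definition schur rho : set 'End(S) :=
  [set A : 'End(S) | forall u v,
     (A \o spin_bracket rho u v)%VF = (spin_bracket rho u v \o A)%VF].

Definition is_sign (e : R) : Prop := e = 1 \/ e = -1.

Definition sign_of (P : Prop) : R := if `[< P >] then 1 else -1.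

Section Forms.
Implicit Type b : bilform S.

Definition form_tau_eq rho b (e : R) : Prop :=
  forall v s t, b (rho v s) t = e * b s (rho v t).

Definition form_sigma_eq b (e : R) : Prop := forall s t, b t s = e * b s t.

Definition form_orthogonal Sp Sm b : Prop :=
  forall s t, s \in Sp -> t \in Sm -> b s t = 0 /\ b t s = 0.

Definition form_isotropic M b : Prop :=
  forall s t, s \in M -> t \in M -> b s t = 0.

Definition adm_form rho Sp Sm : set (bilform S) :=
  [set b : bilform S | [/\ b != 0,
     exists2 e, is_sign e & form_tau_eq rho b e,
     exists2 e, is_sign e & form_sigma_eq b e &
     cl0_reducible rho -> form_orthogonal Sp Sm b \/
       (form_isotropic Sp b /\ form_isotropic Sm b)]].

(* The invariants of an admissible form; the value is -1 when the condition  *)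
(* for +1 fails, so they are meaningful on admissible forms only.            *)
Definition form_tau rho b : R := sign_of (form_tau_eq rho b 1).
Definition form_sigma b : R := sign_of (form_sigma_eq b 1).
Definition form_iota Sp Sm b : R := sign_of (form_orthogonal Sp Sm b).

Definition invariant_scalar_product g rho b : Prop :=
  [/\ forall s t, b s t = b t s, forall s, s != 0 -> 0 < b s s &
      forall v s t, `|g v v| = 1 -> b (rho v s) (rho v t) = b s t].

End Forms.

Section Endomorphisms.
Implicit Types (b : bilform S) (A : 'End(S)).

Definition end_tau_eq rho A (e : R) : Prop :=
  forall v, (A \o rho v)%VF = e *: (rho v \o A)%VF.

Definition end_sigma_eq b A (e : R) : Prop :=
  forall s t, b (A s) t = e * b s (A t).

Definition end_even Sp Sm A : Prop :=
  (A @: Sp <= Sp)%VS /\ (A @: Sm <= Sm)%VS.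

Definition end_odd Sp Sm A : Prop :=
  (A @: Sp <= Sm)%VS /\ (A @: Sm <= Sp)%VS.

Definition adm_end rho Sp Sm b : set 'End(S) :=
  [set A : 'End(S) | [/\ A != 0,
     exists2 e, is_sign e & end_tau_eq rho A e,
     exists2 e, is_sign e & end_sigma_eq b A e &
     cl0_reducible rho -> end_even Sp Sm A \/ end_odd Sp Sm A]].

Definition end_tau rho A : R := sign_of (end_tau_eq rho A 1).
Definition end_sigma b A : R := sign_of (end_sigma_eq b A 1).
Definition end_iota Sp Sm A : R := sign_of (end_even Sp Sm A).

End Endomorphisms.

End CliffordModules.

Section TensorSpinors.
Variables (R : realType) (m : nat) (W2 S2 : vectType R).
Variable rho2 : 'Hom(W2, 'End(S2)).
Local Notation V1 := ('rV[R]_m * 'rV[R]_m)%type.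
Local Notation S := {ffun {set 'I_m} -> S2}.

(* The sign (-1)^(deg s_1) is E s_1. *)
Definition tens_rho : 'Hom((V1 * W2)%type, 'End(S)) :=
  linfun (fun v : V1 * W2 =>
    tens_end (ext_rho R m v.1) \1%VF + tens_end (ext_E R m) (rho2 v.2)).

Definition tens_even (S2p S2m : {vspace S2}) : {vspace S} :=
  (tens_space (ext_even R m) S2p + tens_space (ext_odd R m) S2m)%VS.

Definition tens_odd (S2p S2m : {vspace S2}) : {vspace S} :=
  (tens_space (ext_even R m) S2m + tens_space (ext_odd R m) S2p)%VS.

(* The form on S_1 associated with beta_2 in the definition of phi, and the  *)
(* endomorphism of S_1 associated with A_2 in the definition of psi.         *)
Definition companion_form (vol : ext R m) (b2 : bilform S2)
    (b1 : bilform (ext R m)) : Prop :=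
  (b1 = ext_form vol \/ b1 = ext_form_E vol) /\
  form_tau rho2 b2 = form_iota (ext_even R m) (ext_odd R m) b1 *
                     form_tau (ext_rho R m) b1.

Definition companion_end (A2 : 'End(S2)) (A1 : 'End(ext R m)) : Prop :=
  (A1 = \1%VF \/ A1 = ext_E R m) /\
  end_tau rho2 A2 = end_iota (ext_even R m) (ext_odd R m) A1 *
                    end_tau (ext_rho R m) A1.

Lemma tens_rhoE v s1 s2 : tens_rho v (tens s1 s2) =
  tens (ext_rho R m v.1 s1) s2 + tens (ext_E R m s1) (rho2 v.2 s2).
Proof.
rewrite linfunE ?add_lfunE ?tens_endE ?id_lfunE // => c {}v w.
apply: tens_lfunP => s t.
rewrite !(add_lfunE, scale_lfunE) !tens_endE !id_lfunE /= !linearP /=.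
rewrite !(add_lfunE, scale_lfunE) tens_linearl tens_linearr scalerDr.
by rewrite addrACA.
Qed.

Lemma ext_rho_clifford : clifford_module (@neutral_form R m) (ext_rho R m).
Proof.
move=> v; apply/lfunP=> s; rewrite comp_lfunE scale_lfunE id_lfunE ext_rho_sq.
congr (- _ *: s); rewrite /neutral_form big_split /= mulr_natl mulr2n.
by [].
Qed.

Lemma tens_rho_clifford (g2 : W2 -> W2 -> R) : clifford_module g2 rho2 ->
  clifford_module (orthogonal_sum (@neutral_form R m) g2) tens_rho.
Proof.
move=> cl2 v; apply: tens_lfunP => s t.
rewrite comp_lfunE scale_lfunE id_lfunE tens_rhoE linearD /= !tens_rhoE.
rewrite ext_E_rho ext_E_sq.
have /lfunP/(_ s) := ext_rho_clifford v.1.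
rewrite comp_lfunE scale_lfunE id_lfunE => ->.
have /lfunP/(_ t) := cl2 v.2.
rewrite comp_lfunE scale_lfunE id_lfunE => ->.
apply/ffunP=> A; rewrite !ffunE addrA
  (scaleNr (ext_rho R m v.1 (ext_E R m s) A)) addrNK !scalerA -scalerDl.
by congr (_ *: t); rewrite /orthogonal_sum /GRing.scale /=; ring.
Qed.

End TensorSpinors.

(* Main.v *)
Require Import Defs.
From mathcomp Require Import all_boot all_order all_algebra.
From mathcomp Require Import boolp reals.
From mathcomp Require Import zify ring lra complex.

Set Implicit Arguments.
Unset Strict Implicit.
Unset Printing Implicit Defensive.

Import Order.TTheory GRing.Theory Num.Theory.
Local Open Scope ring_scope.

(** Why the theorem holds.  Write S_1 for the exterior algebra and E for its
    parity operator.  Fix a vector e of V_2 with <e,e> = +-1.  Conjugation by e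
    is an involution of the commutant of the even Clifford algebra of V_2, and
    it splits each element A of it into a part A_+ that commutes with all
    vectors and a part A_- that anticommutes with them ([twist_split]).  Put
    psi(A) = Id (x) A_+ + E (x) A_-.  The same splitting on S = S_1 (x) S_2
    reduces the surjectivity of psi to operators Z with
    Z rho(v) = +- rho(v) Z: composed with Id or E on the first factor, Z
    commutes with Cl(R^{m,m}), whose commutant consists of the operators
    Id (x) B, because products of vectors of R^{m,m} contain the projections
    that separate the lines of the e_A, and single vectors permute these lines
    transitively ([commutant_ext], [tens_end_tau_inv]).  Hence an operator on S
    with a given tau is exactly A_1 (x) A_2, with A_1 in {Id, E} determined by
    tau, and sigma and iota can be read off from the factors.

    Forms are reduced to endomorphisms.  The forms h_2 and h = h_1 (x) h_2 are
    nondegenerate, so each bilinear form is h(A -, -) for a unique A; it is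
    invariant exactly when A commutes with so ([inv_forms_comp]) and admissible
    exactly when A is ([adm_form_comp]).  Thus phi is the conjugate of psi by
    A |-> h_2(A -, -) and Z |-> h(Z -, -).  Since f and f_E have tau = -1 and
    tau = +1, while iota = (-1)^m for both, the form companion to b_2 is unique,
    and h_1(A_1 -, -) is the companion of h_2(A_2 -, -) when A_1 is that of A_2.

    That phi and psi are determined by their values on admissible elements
    means that the admissible endomorphisms span the Schur algebra
    ([schur_admissible_ind]): conjugation by e, the adjoint for h_2 and
    conjugation by the grading operator P of S_2 = S_2^+ + S_2^- are commuting
    involutions.  The adjoint commutes with conjugation by P because P is an
    isometry of h_2: the form h_2(P -, P -) is represented by a positive
    symmetric operator commuting with Cl(V_2), which has a real eigenvalue, so
    by irreducibility it is a scalar, and P^2 = 1 makes that scalar 1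
    ([anti_involution_isometry]).

    Finally S_2 and S are irreducible over the even Clifford algebras at the
    same time ([tens_cl0_reducible]), and E (x) P is the grading operator of S,
    so that every condition on semispinors becomes an equation in P. *)

(** * Bilinear forms and endomorphisms *)

Section Nondegenerate.
Variables (R : realType) (S : vectType R).
Implicit Types (b c : bilform S) (A B : 'End(S)).

(** Triviality of the left kernel, which in finite dimension is equivalent to
    triviality of both kernels. *)
Definition nondegenerate b : Prop := forall s, (forall t, b s t = 0) -> s = 0.

Lemma form_eqP b c : (forall s t, b s t = c s t) -> b = c.
Proof. by move=> e; apply/lfunP => s; apply/lfunP. Qed.

Lemma form_compE b A s t : (b \o A)%VF s t = b (A s) t.
Proof. by rewrite comp_lfunE. Qed.

Lemma formBl b x y t : b (x - y) t = b x t - b y t.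
Proof. by rewrite linearB /= add_lfunE opp_lfunE. Qed.

Lemma formDl b x y t : b (x + y) t = b x t + b y t.
Proof. by rewrite linearD /= add_lfunE. Qed.

Lemma formNl b x t : b (- x) t = - b x t.
Proof. by rewrite linearN /= opp_lfunE. Qed.

Lemma formNr b x t : b t (- x) = - b t x.
Proof. by rewrite linearN. Qed.

Lemma formDr b x y t : b t (x + y) = b t x + b t y.
Proof. by rewrite linearD. Qed.

Lemma formZl b a x t : b (a *: x) t = a * b x t.
Proof. by rewrite linearZ /= scale_lfunE. Qed.

Lemma formZr b a x t : b t (a *: x) = a * b t x.
Proof. by rewrite linearZ. Qed.

Lemma form_neq0 b : b != 0 -> exists s t, b s t != 0.
Proof.
move=> b0; apply: contrapT => n; case/eqP: b0; apply: form_eqP => s t.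
rewrite !zero_lfunE; apply: contrapT => /eqP st; apply: n.
by exists s, t.
Qed.

Variable b : bilform S.
Hypothesis ndb : nondegenerate b.

Lemma nondeg_inj x y : (forall t, b x t = b y t) -> x = y.
Proof.
move=> e; apply/subr0_eq/ndb => t; by rewrite formBl e subrr.
Qed.

Lemma nondeg_endP A B : (forall s t, b (A s) t = b (B s) t) -> A = B.
Proof. by move=> e; apply/lfunP => s; apply: nondeg_inj. Qed.

Lemma nondeg_lker : lker b == 0%VS.
Proof.
apply/lker0P => x y e; apply: nondeg_inj => t; by rewrite e.
Qed.

Lemma nondeg_limg : limg b = fullv.
Proof.
apply/eqP; rewrite eqEdim subvf /= limg_dim_eq ?(eqP nondeg_lker) ?capv0 //.
by rewrite !dimvf /dim /= muln1.
Qed.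

(** Every bilinear form is obtained from a nondegenerate one by composing its
    first argument with an endomorphism. *)
Lemma nondeg_compVK c : (b \o (b^-1 \o c))%VF = c.
Proof.
apply/lfunP => s; rewrite !comp_lfunE limg_lfunVK //.
by rewrite nondeg_limg memvf.
Qed.

Lemma nondeg_compK A : (b^-1 \o (b \o A))%VF = A.
Proof. by apply/lfunP => s; rewrite !comp_lfunE lker0_lfunK ?nondeg_lker. Qed.

Lemma nondeg_comp_neq0 A : (b \o A)%VF != 0 <-> A != 0.
Proof.
split; apply: contra => /eqP e; apply/eqP.
  by rewrite e comp_lfun0r.
by rewrite -(nondeg_compK A) e comp_lfun0r.
Qed.

End Nondegenerate.

(** * Signs and grading operators *)

Section Signs.
Variable R : realType.

Lemma is_sign_sqr (e : R) : is_sign e -> e * e = 1.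
Proof. by case=> ->; rewrite ?mulr1 // mulrNN mulr1. Qed.

Lemma is_signM (e d : R) : is_sign e -> is_sign d -> is_sign (e * d).
Proof.
by case=> ->; case=> ->; rewrite ?mul1r ?mulr1 ?mulrNN ?mulr1; [left|right|right|left].
Qed.

Lemma is_sign_exp n : is_sign ((-1) ^+ n : R).
Proof. by rewrite -signr_odd; case: (odd n); [right|left]. Qed.

Lemma sign_mulI (e d : R) : is_sign e -> e * (e * d) = d.
Proof. by move=> /is_sign_sqr ee; rewrite mulrA ee mul1r. Qed.

(** The value of an invariant that is defined by a condition which cannot
    hold for both signs. *)
Lemma sign_ofE (P : R -> Prop) e : is_sign e -> P e -> (P 1 -> P (-1) -> False) ->
  sign_of R (P 1) = e.
Proof.
move=> se Pe excl; rewrite /sign_of; case: asboolP => P1.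
  by case: se Pe => -> // /(excl P1).
by case: se Pe => ->.
Qed.

Lemma sign1N : (-1 == 1 :> R) = false.
Proof. by apply/negbTE; rewrite -subr_eq0 -opprD oppr_eq0 -[1 + 1]/(2%:R) pnatr_eq0. Qed.

Lemma eq_oppr0 (T : lmodType R) (x : T) : x = - x -> x = 0.
Proof.
move/eqP; rewrite -addr_eq0 -mulr2n -scaler_nat scaler_eq0 pnatr_eq0 /=.
by move/eqP.
Qed.

Lemma double_inj (T : lmodType R) (x y : T) : x + x = y + y -> x = y.
Proof.
move=> e; apply/subr0_eq/eq_oppr0; rewrite opprB.
by apply/eqP; rewrite subr_eq addrAC eq_sym subr_eq e.
Qed.

Lemma sum_diff_eq (T : lmodType R) (p q x y : T) :
  p + q = x + y -> p - q = y - x -> p = y.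
Proof.
move=> a b; apply: double_inj; have := congr2 +%R a b.
by rewrite addrACA subrr addr0 [x + y + _]addrC addrA addrNK.
Qed.

Lemma half_sum (T : lmodType R) (x y : T) :
  x = 2^-1 *: (x + y) + 2^-1 *: (x - y).
Proof.
rewrite -scalerDr addrACA subrr addr0 -mulr2n -scaler_nat scalerA mulVf ?scale1r //.
by rewrite pnatr_eq0.
Qed.

End Signs.

Section Gradings.
Variables (R : realType) (S : vectType R).
Variables (Sp Sm : {vspace S}) (P : 'End(S)).
Implicit Types (b : bilform S) (A : 'End(S)).

(** The involution of S that is 1 on S^+ and -1 on S^-. *)
Definition grading : Prop :=
  [/\ forall s, P (P s) = s, forall s, s \in Sp <-> P s = s &
      forall s, s \in Sm <-> P s = - s].

(** b is even (e = 1) or odd (e = -1) for the grading P. *)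
Definition form_iota_eq b (e : R) : Prop := forall s t, b (P s) (P t) = e * b s t.

(** A commutes (e = 1) or anticommutes (e = -1) with P. *)
Definition end_iota_eq A (e : R) : Prop := forall s, P (A s) = e *: A (P s).

Hypothesis gP : grading.

Lemma grading_even s : s + P s \in Sp.
Proof. by case: gP => PP /(_ (s + P s)) [_ e] _; apply: e; rewrite linearD /= PP addrC. Qed.

Lemma grading_odd s : s - P s \in Sm.
Proof.
by case: gP => PP _ /(_ (s - P s)) [_ e]; apply: e; rewrite linearB /= PP opprB.
Qed.

Lemma form_orthogonalE b : form_orthogonal Sp Sm b <-> form_iota_eq b 1.
Proof.
have [PP Pp Pm] := gP.
split=> [o s t|i s t /Pp sp /Pm tm]; last first.
  split; apply: (@eq_oppr0 R R^o).
    by rewrite -[LHS]mul1r -i sp tm formNr.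
  by rewrite -[LHS]mul1r -i sp tm formNl.
rewrite mul1r; apply/esym/(@double_inj R R^o).
have [a _] := o _ _ (grading_even s) (grading_odd t).
have [_ b'] := o _ _ (grading_even t) (grading_odd s).
move: a b'; rewrite !(formDl, formDr, formNl, formNr) => a b'.
by apply/subr0_eq; transitivity (0 + 0 : R^o); [rewrite -{1}a -{1}b'; ring | rewrite addr0].
Qed.

Lemma form_isotropicE b :
  form_isotropic Sp b /\ form_isotropic Sm b <-> form_iota_eq b (-1).
Proof.
have [PP Pp Pm] := gP.
split=> [[op om] s t|i]; last first.
  split=> s t.
    move=> /Pp es /Pp et; apply: (@eq_oppr0 R R^o).
    by rewrite -{1}es -{1}et i mulN1r.
  move=> /Pm es /Pm et; apply: (@eq_oppr0 R R^o).
  by rewrite -mulN1r -i es et formNl formNr opprK.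
rewrite mulN1r; apply/(@double_inj R R^o).
have a := op _ _ (grading_even s) (grading_even t).
have b' := om _ _ (grading_odd s) (grading_odd t).
move: a b'; rewrite !(formDl, formDr, formNl, formNr) => a b'.
by apply/subr0_eq; transitivity (0 + 0 : R^o); [rewrite -{1}a -{1}b'; ring | rewrite addr0].
Qed.

Lemma subv_limgP A (M N : {vspace S}) :
  (A @: M <= N)%VS <-> forall s, s \in M -> A s \in N.
Proof.
split=> [/subvP sub s sM|sub]; first by apply/sub/memv_img.
by apply/subvP => _ /memv_imgP[s sM ->]; apply: sub.
Qed.

Lemma end_evenE A : end_even Sp Sm A <-> end_iota_eq A 1.
Proof.
have [PP Pp Pm] := gP; rewrite /end_even; split=> [[/subv_limgP ep /subv_limgP em] s|i].
  have /Pp := ep _ (grading_even s); have /Pm := em _ (grading_odd s).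
  rewrite scale1r !(linearD, linearN) /= => b a.
  by apply: sum_diff_eq a _; rewrite b opprK addrC.
split; apply/subv_limgP => s.
  by move/Pp => e; apply/Pp; rewrite i e scale1r.
by move/Pm => e; apply/Pm; rewrite i e scale1r linearN.
Qed.

Lemma end_oddE A : end_odd Sp Sm A <-> end_iota_eq A (-1).
Proof.
have [PP Pp Pm] := gP; rewrite /end_odd; split=> [[/subv_limgP ep /subv_limgP em] s|i].
  have /Pm := ep _ (grading_even s); have /Pp := em _ (grading_odd s).
  rewrite scaleN1r !(linearD, linearN) /= => b a.
  by apply: sum_diff_eq a _; rewrite b opprK addrC.
split; apply/subv_limgP => s.
  by move/Pp => e; apply/Pm; rewrite i e scaleN1r.
by move/Pm => e; apply/Pp; rewrite i e scaleN1r linearN opprK.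
Qed.

Lemma form_iotaE b e : b != 0 -> is_sign e -> form_iota_eq b e ->
  form_iota Sp Sm b = e.
Proof.
move=> b0 se i; rewrite /form_iota.
rewrite (_ : form_orthogonal _ _ _ = form_iota_eq b 1); last first.
  exact/propext/form_orthogonalE.
apply: sign_ofE => // i1 iN; have [s [t /eqP]] := form_neq0 b0; apply.
by have := i1 s t; rewrite iN mulN1r mul1r => /esym/(@eq_oppr0 R R^o).
Qed.

Lemma end_iotaE A e : A != 0 -> is_sign e -> end_iota_eq A e ->
  end_iota Sp Sm A = e.
Proof.
move=> A0 se i; rewrite /end_iota.
rewrite (_ : end_even _ _ _ = end_iota_eq A 1); last exact/propext/end_evenE.
apply: sign_ofE => // i1 iN; case/eqP: A0; apply/lfunP => s.
have [PP _ _] := gP.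
by have := i1 (P s); rewrite iN PP scaleN1r scale1r zero_lfunE => /esym/eq_oppr0.
Qed.

End Gradings.

(** * Clifford modules and their Schur algebras *)

Section CliffordTheory.
Variables (R : realType) (W S : vectType R) (rho : 'Hom(W, 'End(S))).
Variable g : W -> W -> R.
Hypothesis cl : clifford_module g rho.
Implicit Types (b : bilform S) (A : 'End(S)).

Lemma clifford_sq v s : rho v (rho v s) = - g v v *: s.
Proof. by have /lfunP/(_ s) := cl v; rewrite comp_lfunE scale_lfunE id_lfunE. Qed.

Lemma clifford_polar u v s : rho u (rho v s) + rho v (rho u s) =
  (- g (u + v) (u + v) + g u u + g v v) *: s.
Proof.
have solve (a p q b d : S) : a + p + (q + b) = d -> p + q = d - a - b.
  by move=> <-; rewrite addrA (addrAC _ (- a)) addrK -(addrA a) [a + _]addrC addrK.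
have := clifford_sq (u + v) s.
rewrite linearD /= !add_lfunE !linearD /= !clifford_sq => /solve ->.
by rewrite !scalerDl !scaleNr !opprK.
Qed.

(** Commuting with so(W) amounts to commuting with the products of two
    vectors, since [u, v] and 2 u v differ by a scalar. *)
Lemma schurP A : schur rho A <->
  forall u v s, A (rho u (rho v s)) = rho u (rho v (A s)).
Proof.
split=> [sA u v s|cA u v]; last first.
  apply/lfunP => s; rewrite /spin_bracket !comp_lfunE !(add_lfunE, opp_lfunE).
  by rewrite !comp_lfunE linearB /= !cA.
have /lfunP/(_ s) := sA u v.
rewrite /spin_bracket !comp_lfunE !(add_lfunE, opp_lfunE) !comp_lfunE linearB /= => br.
apply: double_inj; set x := A _; set y := rho u _.
have := congr1 A (clifford_polar u v s).
rewrite linearD linearZ /= -clifford_polar -/x -/y => ac.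
have := congr2 +%R ac br.
by rewrite addrACA subrr addr0 addrACA subrr addr0.
Qed.

Lemma end_tau_eqP A e :
  end_tau_eq rho A e <-> forall v s, A (rho v s) = e *: rho v (A s).
Proof.
split=> [t v s|t v].
  by have /lfunP/(_ s) := t v; rewrite scale_lfunE !comp_lfunE.
by apply/lfunP => s; rewrite scale_lfunE !comp_lfunE.
Qed.

Lemma end_tau_schur A e : is_sign e -> end_tau_eq rho A e -> schur rho A.
Proof.
move=> se /end_tau_eqP t; apply/schurP => u v s.
by rewrite !t linearZ /= scalerA is_sign_sqr // scale1r.
Qed.

(** For a nondegenerate form b with tau = d, the form b(A -, -) is
    so(W)-invariant exactly when A commutes with so(W). *)
Lemma inv_forms_comp b A d : nondegenerate b -> is_sign d -> form_tau_eq rho b d ->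
  inv_forms rho (b \o A)%VF <-> schur rho A.
Proof.
move=> ndb sd tb.
have skew u v s t : b (spin_bracket rho u v s) t = - b s (spin_bracket rho u v t).
  rewrite /spin_bracket !(add_lfunE, opp_lfunE) !comp_lfunE.
  rewrite !(formDl, formDr, formNl, formNr) !tb !(sign_mulI _ sd).
  by rewrite opprB addrC.
split=> [ib u v|sA u v s t].
  apply: (nondeg_endP ndb) => s t; rewrite !comp_lfunE skew.
  by have := ib u v s t; rewrite !form_compE => /eqP; rewrite addr_eq0 => /eqP.
have /lfunP/(_ s) := sA u v; rewrite !form_compE !comp_lfunE => ->.
by rewrite skew addNr.
Qed.

Variable w : W.
Hypothesis gw : g w w != 0.

Lemma clifford_inv s : s = - (g w w)^-1 *: rho w (rho w s).
Proof. by rewrite clifford_sq scalerA mulrNN mulVf ?scale1r. Qed.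

Lemma clifford_inj s : rho w s = 0 -> s = 0.
Proof. by move=> e; rewrite [s]clifford_inv e linear0 scaler0. Qed.

Lemma form_tauE b e : b != 0 -> is_sign e -> form_tau_eq rho b e ->
  form_tau rho b = e.
Proof.
move=> b0 se te; apply: (sign_ofE se te) => t1 tN.
have [s [t /eqP]] := form_neq0 b0; apply.
rewrite [s]clifford_inv formZl; set x := rho w s.
suff -> : b (rho w x) t = 0 by rewrite mulr0.
apply: (@eq_oppr0 R R^o); rewrite {1}tN mulN1r; congr (- _).
by rewrite t1 mul1r.
Qed.

Lemma end_tauE A e : A != 0 -> is_sign e -> end_tau_eq rho A e ->
  end_tau rho A = e.
Proof.
move=> A0 se te; apply: (sign_ofE se te) => /end_tau_eqP t1 /end_tau_eqP tN.
case/eqP: A0; apply/lfunP => s; rewrite zero_lfunE; apply: clifford_inj.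
by have := t1 w s; rewrite tN scaleN1r scale1r => /esym/eq_oppr0.
Qed.

(** Conjugation by an anisotropic vector: it does not depend on the vector on
    the commutant of the even Clifford algebra, where it is an involution whose
    eigenspaces are the endomorphisms with tau = 1 and tau = -1. *)
Definition twist A : 'End(S) := - (g w w)^-1 *: (rho w \o A \o rho w)%VF.

Lemma twistE A s : twist A s = - (g w w)^-1 *: rho w (A (rho w s)).
Proof. by rewrite scale_lfunE !comp_lfunE. Qed.

Lemma twist_rho A v s : schur rho A ->
  twist A (rho v s) = rho v (A s) /\ rho v (twist A s) = A (rho v s).
Proof.
move/schurP => sA; rewrite !twistE; split.
  by rewrite sA -clifford_inv.
by rewrite linearZ /= -sA -linearZ /= -linearZ /= -clifford_inv.
Qed.

Lemma twist_split A : schur rho A ->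
  end_tau_eq rho (2^-1 *: (A + twist A)) 1 /\
  end_tau_eq rho (2^-1 *: (A - twist A)) (-1).
Proof.
move=> sA; split; apply/end_tau_eqP => v s;
    rewrite !scale_lfunE !(add_lfunE, opp_lfunE) linearZ /= ?linearB ?linearD /=;
    have [-> ->] := twist_rho v s sA.
  by rewrite !scale1r addrC.
by rewrite !scaleN1r opprK addrC.
Qed.

Lemma twist_tau A e : is_sign e -> end_tau_eq rho A e -> twist A = e *: A.
Proof.
move=> se /end_tau_eqP t; apply/lfunP => s.
rewrite twistE t linearZ /= scalerA mulrC -scalerA -clifford_inv.
by rewrite scale_lfunE.
Qed.

End CliffordTheory.

Section Adjunction.
Variables (R : realType) (W S : vectType R) (rho : 'Hom(W, 'End(S))).
Variables (b : bilform S) (P : 'End(S)) (A : 'End(S)).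
Hypothesis ndb : nondegenerate b.

Lemma form_sigmaE (c : bilform S) e : c != 0 -> is_sign e -> form_sigma_eq c e ->
  form_sigma c = e :> R.
Proof.
move=> c0 se t; apply: (sign_ofE se t) => s1 sN.
have [s [t' /eqP]] := form_neq0 c0; apply; apply: (@eq_oppr0 R R^o).
by rewrite {1}s1 sN mul1r mulN1r.
Qed.

Lemma end_sigmaE e : A != 0 -> is_sign e -> end_sigma_eq b A e ->
  end_sigma b A = e.
Proof.
move=> A0 se t; apply: (sign_ofE se t) => s1 sN.
case/eqP: A0; apply/lfunP => s; rewrite zero_lfunE; apply: ndb => t'.
by apply: (@eq_oppr0 R R^o); rewrite {1}s1 sN mul1r mulN1r opprK.
Qed.

Lemma form_tau_comp d e : is_sign d -> form_tau_eq rho b d ->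
  form_tau_eq rho (b \o A)%VF (d * e) <-> end_tau_eq rho A e.
Proof.
move=> sd tb; rewrite end_tau_eqP; split=> [t v s|t v s s'].
  apply: (nondeg_inj ndb) => s'; have := t v s s'; rewrite !form_compE => ->.
  by rewrite formZl tb mulrA [d * e]mulrC.
by rewrite !form_compE t formZl tb mulrCA mulrA.
Qed.

Lemma form_sigma_comp d e : is_sign d -> form_sigma_eq b d ->
  form_sigma_eq (b \o A)%VF (d * e) <-> end_sigma_eq b A e.
Proof.
move=> sd sb; split=> [t s s'|t s s'].
  have := t s' s; rewrite !form_compE [b (A s') s]sb => ->.
  by rewrite mulrACA (is_sign_sqr sd) mul1r.
by rewrite !form_compE t sb mulrCA mulrA.
Qed.

Lemma form_iota_comp d e : (forall s, P (P s) = s) -> is_sign d -> is_sign e ->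
  form_iota_eq P b d ->
  form_iota_eq P (b \o A)%VF (d * e) <-> end_iota_eq P A e.
Proof.
move=> PP sd se ib; split=> [t s|t s s'].
  apply: (nondeg_inj ndb) => s'; rewrite -[s']PP formZl ib.
  have := t s (P s'); rewrite !form_compE => ->.
  by rewrite !mulrA [e * d]mulrC -mulrA -mulrA sign_mulI // mulrCA sign_mulI.
rewrite !form_compE; have := ib (A s) s'; rewrite t formZl => ib'.
by rewrite -mulrA mulrCA -ib' sign_mulI.
Qed.

End Adjunction.

Section AdmissibleComp.
Variables (R : realType) (W S : vectType R) (rho : 'Hom(W, 'End(S))).
Variables (Sp Sm : {vspace S}) (b : bilform S) (A P : 'End(S)) (d e i : R).
Hypothesis ndb : nondegenerate b.
Hypotheses (sd : is_sign d) (se : is_sign e) (si : is_sign i).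
Hypotheses (tb : form_tau_eq rho b d) (sb : form_sigma_eq b e).
Hypothesis gb : cl0_reducible rho -> grading Sp Sm P /\ form_iota_eq P b i.

Lemma exists_sign_scale (F G : R -> Prop) c : is_sign c ->
  (forall x, is_sign x -> F (c * x) <-> G x) ->
  (exists2 x, is_sign x & F x) <-> (exists2 x, is_sign x & G x).
Proof.
move=> sc FG; split=> -[x sx].
  move=> Fx; exists (c * x); first exact: is_signM.
  by apply/FG; rewrite ?sign_mulI //; exact: is_signM.
by move=> /FG Fx; exists (c * x); [exact: is_signM | exact: Fx].
Qed.

Lemma exists_signE (F : R -> Prop) (P1 PN : Prop) :
  (P1 <-> F 1) -> (PN <-> F (-1)) -> (P1 \/ PN <-> exists2 x, is_sign x & F x).
Proof.
move=> e1 eN; split=> [[/e1|/eN] h|[x [->|->]]].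
- by exists 1 => //; left.
- by exists (-1) => //; right.
- by move/e1; left.
by move/eN; right.
Qed.

(** For an admissible nondegenerate form b, the form b(A -, -) is admissible
    exactly when A is b-admissible: each invariant of the form is that of b
    times that of A. *)
Lemma adm_form_comp : adm_form rho Sp Sm (b \o A)%VF <-> adm_end rho Sp Sm b A.
Proof.
have tE := exists_sign_scale sd (fun x _ => form_tau_comp A ndb x sd tb).
have sE := exists_sign_scale se (fun x _ => form_sigma_comp A x se sb).
have iE : cl0_reducible rho ->
    (form_orthogonal Sp Sm (b \o A)%VF \/
     (form_isotropic Sp (b \o A)%VF /\ form_isotropic Sm (b \o A)%VF)) <->
    (end_even Sp Sm A \/ end_odd Sp Sm A).
  move=> /gb[gP ib]; have [PP _ _] := gP.
  rewrite (exists_signE (form_orthogonalE gP _) (form_isotropicE gP _)).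
  rewrite (exists_signE (end_evenE gP A) (end_oddE gP A)).
  exact: (exists_sign_scale si (fun x sx => form_iota_comp A ndb PP si sx ib)).
split=> -[/(nondeg_comp_neq0 ndb) n /tE t /sE s r]; split=> // red;
  exact/(iE red)/r.
Qed.

End AdmissibleComp.

(** * The exterior algebra and the form f *)

Section Inversions.
Variable m : nat.
Implicit Types (A B C : {set 'I_m}) (i : 'I_m).

Lemma inversionsE A B :
  inversions A B = (\sum_(a in A) \sum_(b in B) (b < a))%N.
Proof.
rewrite pair_big_dep /= /inversions -sum1_card.
rewrite [LHS](eq_bigl (fun p : 'I_m * 'I_m =>
  [&& p.1 \in A, p.2 \in B & (p.2 < p.1)%N])) => [|p]; last first.
  by rewrite !inE andbA.
rewrite [RHS]big_mkcond [LHS]big_mkcond; apply: eq_bigr => -[a b] _ /=.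
by case: (a \in A); case: (b \in B) => //=; case: ifP.
Qed.

Lemma inversions_addl A B C : [disjoint A & B] ->
  inversions (A :|: B) C = (inversions A C + inversions B C)%N.
Proof.
by move=> dAB; rewrite !inversionsE -bigU //; apply: eq_bigl => a; rewrite !inE.
Qed.

Lemma inversions_addr A B C : [disjoint A & B] ->
  inversions C (A :|: B) = (inversions C A + inversions C B)%N.
Proof.
move=> dAB; rewrite !inversionsE -big_split; apply: eq_bigr => c _ /=.
by rewrite -bigU //; apply: eq_bigl => a; rewrite !inE.
Qed.

Lemma inversions_swap A B : [disjoint A & B] ->
  (inversions A B + inversions B A = #|A| * #|B|)%N.
Proof.
move=> dAB; rewrite !inversionsE [X in (_ + X)%N]exchange_big -big_split /=.
rewrite -sum1_card big_distrl /=; apply: eq_bigr => a aA.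
rewrite -big_split mul1n -sum1_card; apply: eq_bigr => b bB /=.
have : a != b by apply: contraTneq bB => <-; rewrite (disjointFr dAB).
by rewrite -val_eqE /=; case: ltngtP.
Qed.

End Inversions.

Section ExteriorForms.
Variables (R : realType) (m : nat) (vol : ext R m).
Implicit Types (A B C : {set 'I_m}) (i : 'I_m) (s t : ext R m).

(** f(e_A, e_B) = 0 unless B is the complement of A, when it is ext_coef A up
    to the normalisation by vol. *)
Definition ext_coef A : R :=
  (-1) ^+ inversions A (~: A) * (-1) ^+ (#|A| * #|A|.+1)./2.

Lemma ext_formS s t : ext_form vol s t =
  (\sum_A ext_coef A * s A * t (~: A)) / vol [set: 'I_m].
Proof.
rewrite ext_formE /ext_form_fun ffunE; congr (_ / _).
apply: eq_big => [A|A _]; first by rewrite inE subsetT.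
by rewrite setTD ffunE /ext_coef !mulrA.
Qed.

Lemma ext_coef_neq0 A : ext_coef A != 0.
Proof. by rewrite /ext_coef mulf_neq0 // signr_eq0. Qed.

Lemma sign_half_succ n : (-1) ^+ (n.+1 * n.+2)./2 =
  (-1) ^+ n.+1 * (-1) ^+ (n * n.+1)./2 :> R.
Proof.
rewrite -exprD; congr (_ ^+ _).
have -> : (n.+1 * n.+2 = n.+1.*2 + n * n.+1)%N by rewrite -mul2n mulnC -mulnDl.
by rewrite halfD odd_double add0n doubleK.
Qed.

(** The sign identity behind tau(f) = -1, for exterior multiplication by e_i.
    The lemma [ext_form_tau] also uses it, with the signs moved to the other
    sides, for the contraction with e_i^*. *)
Lemma ext_coefU i A : i \notin A ->
  ext_coef (i |: A) * (-1) ^+ inversions [set i] A =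
  - ext_coef A * (-1) ^+ inversions [set i] (~: A :\ i).
Proof.
move=> iA; rewrite /ext_coef cardsU1 iA add1n sign_half_succ setCU setIC -setDE.
have dA : [disjoint [set i] & A] by rewrite disjoints1.
rewrite (inversions_addl _ dA).
have -> : inversions A (~: A) =
    (inversions A [set i] + inversions A (~: A :\ i))%N.
  by rewrite -inversions_addr ?setD1K ?disjoints1 ?inE ?eqxx.
rewrite !exprD exprS.
have : (-1) ^+ #|A| = (-1) ^+ inversions [set i] A * (-1) ^+ inversions A [set i] :> R.
  by rewrite -exprD inversions_swap // cards1 mul1n.
move=> ->; set a := (-1) ^+ inversions [set i] A.
have := sqrr_sign R (inversions [set i] A); rewrite -/a => a2.
transitivity (- (a ^+ 2) * (-1) ^+ inversions A [set i] *
   (-1) ^+ inversions [set i] (~: A :\ i) * (-1) ^+ inversions A (~: A :\ i) *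
   (-1) ^+ (#|A| * #|A|.+1)./2); first by ring.
by rewrite a2; ring.
Qed.

Lemma ext_coefC A : ext_coef (~: A) = (-1) ^+ (m * m.+1)./2 * ext_coef A.
Proof.
rewrite /ext_coef setCK.
have dA : [disjoint ~: A & A] by rewrite disjoints_subset.
have cA : (#|~: A| + #|A| = m)%N by rewrite addnC cardsC card_ord.
have := inversions_swap dA; move: cA; move: #|~: A| #|A| => p q pq sw.
have -> : (-1) ^+ inversions (~: A) A =
    (-1) ^+ (p * q) * (-1) ^+ inversions A (~: A) :> R.
  by rewrite -sw exprD -mulrA -expr2 sqrr_sign mulr1.
have -> : (m * m.+1 = p * p.+1 + q * q.+1 + (p * q).*2)%N.
  by rewrite -pq -mul2n; nia.
rewrite halfD odd_double andbF add0n doubleK halfD.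
have -> : odd (p * p.+1) = false by rewrite oddM /= andbN.
rewrite add0n !exprD.
have := sqrr_sign R (q * q.+1)./2; set a := (-1) ^+ (q * q.+1)./2 => a2.
transitivity (a ^+ 2 * (-1) ^+ (p * q) * (-1) ^+ inversions A (~: A) *
  (-1) ^+ (p * p.+1)./2); first by rewrite a2; ring.
by ring.
Qed.

Lemma sum_reindexU (F : 'I_m -> {set 'I_m} -> R) :
  \sum_(A : {set 'I_m}) \sum_(i in A) F i A =
  \sum_(A : {set 'I_m}) \sum_(i in ~: A) F i (i |: A).
Proof.
rewrite (exchange_big_dep predT) //= [RHS](exchange_big_dep predT) //=.
apply: eq_bigr => i _.
rewrite (reindex_onto (fun A => i |: A) (fun A => A :\ i)) => [|A iA] /=; last first.
  by rewrite setD1K.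
apply: eq_bigl => A; rewrite setU11 !inE /=.
apply/eqP/idP => [<-|iA]; first by rewrite !inE eqxx.
by rewrite setU1K.
Qed.

Lemma ext_form_tau : form_tau_eq (ext_rho R m) (ext_form vol) (-1).
Proof.
move=> v s t; rewrite !ext_rhoE !ext_formS mulrA; congr (_ / _).
pose u := v.1; pose a := v.2.
have valE (x : ext R m) C : ext_rho_fun v x C =
   (\sum_(i in C) (-1) ^+ inversions [set i] (C :\ i) * u 0 i * x (C :\ i)) +
   (-2 * \sum_(i in ~: C) (-1) ^+ inversions [set i] C * a 0 i * x (i |: C)).
  rewrite /ext_rho_fun -scaleNr ffunE wedge_vecE; congr (_ + _).
  rewrite ffunE [interior _ _ _]ffunE; congr (_ * _).
  by apply: eq_bigl => i; rewrite inE.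
have coefUl i A : i \in ~: A ->
    ext_coef A * (-1) ^+ inversions [set i] A =
    - ext_coef (i |: A) * (-1) ^+ inversions [set i] (~: A :\ i).
  rewrite inE => iA; have e := ext_coefU iA.
  have := sqrr_sign R (inversions [set i] A).
  have := sqrr_sign R (inversions [set i] (~: A :\ i)).
  move: e; set x := (-1) ^+ _; set y := (-1) ^+ _ => e yy xx.
  transitivity (- (ext_coef (i |: A) * x) * x * y).
    by rewrite e -[LHS]mulr1 -yy; ring.
  by rewrite -[RHS]mulr1 -xx; ring.
have compU i A : ~: (i |: A) = ~: A :\ i by rewrite setCU setIC -setDE.
transitivity (
  \sum_(A : {set 'I_m}) \sum_(i in A) ext_coef A *
     ((-1) ^+ inversions [set i] (A :\ i) * u 0 i * s (A :\ i)) * t (~: A) +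
  \sum_(A : {set 'I_m}) \sum_(i in ~: A) ext_coef A *
     (-2 * ((-1) ^+ inversions [set i] A * a 0 i * s (i |: A))) * t (~: A)).
  rewrite -big_split; apply: eq_bigr => A _ /=.
  by rewrite valE mulrDr mulrDl !mulr_sumr !mulr_suml.
rewrite sum_reindexU.
transitivity (-1 * (
  \sum_(A : {set 'I_m}) \sum_(i in ~: A) ext_coef A * s A *
     ((-1) ^+ inversions [set i] (~: A :\ i) * u 0 i * t (~: A :\ i)) +
  \sum_(A : {set 'I_m}) \sum_(i in A) ext_coef A * s A *
     (-2 * ((-1) ^+ inversions [set i] (~: A) * a 0 i * t (i |: ~: A))))).
  rewrite [X in _ * (_ + X)]sum_reindexU mulrDr !mulr_sumr; congr (_ + _).
    apply: eq_bigr => A _; rewrite mulr_sumr; apply: eq_bigr => i iA.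
    have iNA : i \notin A by rewrite inE in iA.
    rewrite setU1K // compU.
    transitivity (ext_coef (i |: A) * (-1) ^+ inversions [set i] A *
      (u 0 i * s A * t (~: A :\ i))); first by ring.
    by rewrite ext_coefU //; ring.
  apply: eq_bigr => A _; rewrite mulr_sumr; apply: eq_bigr => i iA.
  rewrite compU setD1K //.
  transitivity (ext_coef A * (-1) ^+ inversions [set i] A *
    (- 2 * a 0 i * s (i |: A) * t (~: A))); first by ring.
  by rewrite coefUl //; ring.
congr (_ * _); rewrite -big_split; apply: eq_bigr => A _ /=.
rewrite valE mulrDr !mulr_sumr; congr (_ + _).
by apply: eq_bigl => i; rewrite setCK.
Qed.

Lemma ext_form_sigma : form_sigma_eq (ext_form vol) ((-1) ^+ (m * m.+1)./2).
Proof.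
move=> s t; rewrite !ext_formS mulrA mulr_sumr; congr (_ / _).
rewrite (reindex_inj (inv_inj (@setCK _))) /=; apply: eq_bigr => A _.
by rewrite setCK ext_coefC; ring.
Qed.

Lemma ext_EEc s A : ext_E R m s A = (-1) ^+ #|A| * s A.
Proof. by rewrite ext_EE ffunE. Qed.

Lemma ext_form_iota : form_iota_eq (ext_E R m) (ext_form vol) ((-1) ^+ m).
Proof.
move=> s t; rewrite !ext_formS mulrA mulr_sumr; congr (_ / _).
apply: eq_bigr => A _; rewrite !ext_EEc.
rewrite -[in (-1) ^+ m](card_ord m) -(cardsC A) exprD; ring.
Qed.

Lemma ext_form_nondeg : ext_deg m vol -> vol != 0 -> nondegenerate (ext_form vol).
Proof.
move=> dv v0 s s0; apply/ffunP => A; rewrite ffunE.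
have := s0 (ffbasis R (~: A)); rewrite ext_formS (bigD1 A) //= big1 => [|B BA].
  rewrite ffunE eqxx addr0 mulr1 => /eqP; rewrite mulf_eq0 invr_eq0.
  rewrite (negPf (vol_top dv v0)) orbF mulf_eq0 (negPf (ext_coef_neq0 A)) /=.
  by move/eqP.
rewrite ffunE (_ : (_ == _) = false) ?mulr0 //; apply/negbTE.
by apply: contra BA => /eqP/setC_inj ->.
Qed.

Lemma ext_form_dual A s : ext_form vol s (ffbasis R (~: A)) = 
  ext_coef A / vol [set: 'I_m] * s A.
Proof.
rewrite ext_formS (bigD1 A) //= big1 => [|B BA].
  by rewrite ffunE eqxx addr0 mulr1; ring.
rewrite ffunE (_ : (_ == _) = false) ?mulr0 //; apply/negbTE.
by apply: contra BA => /eqP/setC_inj ->.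
Qed.

End ExteriorForms.

Section ExteriorGrading.
Variables (R : realType) (m : nat).
Implicit Types (A B C : {set 'I_m}) (i : 'I_m) (s t : ext R m).

Lemma ext_E_basis A : ext_E R m (ffbasis R A) = (-1) ^+ #|A| *: ffbasis R A.
Proof.
by apply/ffunP => B; rewrite ext_EEc !ffunE; case: eqVneq => [->|_]; rewrite ?scaler0 ?mulr0.
Qed.

Lemma span_ffbasis (p : pred {set 'I_m}) s :
  s \in <<[seq ffbasis R A | A <- enum {set 'I_m} & p A]>>%VS <->
  (forall A, ~~ p A -> s A = 0).
Proof.
split=> [sp A pA|s0].
  have evl : linear (fun x : ext R m => x A) by move=> c x y; rewrite !ffunE.
  have /subvP/(_ _ sp) :
      (<<[seq ffbasis R A | A <- enum {set 'I_m} & p A]>> <=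
       lker (linfun (fun x : ext R m => x A)))%VS.
    apply/span_subvP => _ /mapP[B pB ->]; rewrite mem_filter in pB.
    rewrite memv_ker linfunE // ffunE; case: (eqVneq B A) pB => [-> /andP[pA']|//].
    by rewrite pA' in pA.
  by rewrite memv_ker linfunE // => /eqP.
rewrite [s]ffbasis_sum; apply: memv_suml => A _.
have [pA|/s0 ->] := boolP (p A); last by rewrite scale0r mem0v.
apply/memvZ/memv_span/map_f; rewrite mem_filter pA /=.
exact: mem_enum.
Qed.

Lemma ext_grading : grading (ext_even R m) (ext_odd R m) (ext_E R m).
Proof.
split=> [s|s|s]; first exact: ext_E_sq.
  rewrite span_ffbasis; split=> [s0|e A].
    apply/ffunP => A; rewrite ext_EEc -signr_odd.
    by have [oA|] := boolP (odd #|A|); [rewrite s0 ?mulr0 ?negbK | rewrite mul1r].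
  rewrite negbK => oA; apply: (@eq_oppr0 R R^o).
  by rewrite -{1}e ext_EEc -signr_odd oA mulN1r.
rewrite span_ffbasis; split=> [s0|e A].
  apply/ffunP => A; rewrite ext_EEc -signr_odd [RHS]ffunE.
  by have [oA|/s0->] := boolP (odd #|A|); [rewrite mulN1r | rewrite mulr0 oppr0].
move=> oA; apply: (@eq_oppr0 R R^o).
have : ext_E R m s A = - s A by rewrite e ffunE.
by rewrite ext_EEc -signr_odd (negPf oA) mul1r.
Qed.

(** The symmetric difference of C with {i}. *)
Definition toggle i C : {set 'I_m} := if i \in C then C :\ i else i |: C.

(** The vector (e_i, - e_i^* / 2) has square - <v,v> = 1 and maps each e_C to
    e_(toggle i C) up to sign. *)
Definition flip_vec i : 'rV[R]_m * 'rV[R]_m :=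
  (delta_mx 0 i, - 2^-1 *: delta_mx 0 i).

Lemma ext_rho_flip i s C : ext_rho R m (flip_vec i) s C =
  (-1) ^+ inversions [set i] (C :\ i) * s (toggle i C).
Proof.
rewrite ext_rhoE /ext_rho_fun -scaleNr ffunE wedge_vecE ffunE [interior _ _ _]ffunE.
rewrite /toggle; case: ifP => iC.
  rewrite (bigD1 i) //= big1 => [|j /andP[_ ji]]; last first.
    by rewrite mxE eqxx (negPf ji) /= mulr0 mul0r.
  rewrite mxE !eqxx mulr1 addr0 big1 ?scaler0 ?addr0 // => j jC.
  rewrite !mxE eqxx (_ : j == i = false) /= ?mulr0 ?mul0r //.
  by apply/negP => /eqP e; rewrite e iC in jC.
rewrite big1 => [|j jC]; last first.
  rewrite !mxE eqxx (_ : j == i = false) /= ?mulr0 ?mul0r //.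
  by apply/negP => /eqP e; rewrite -e jC in iC.
rewrite add0r (bigD1 i) ?iC //= big1 => [|j /andP[_ ji]]; last first.
  by rewrite !mxE eqxx (negPf ji) /= !mulr0 mul0r.
have -> : C :\ i = C.
  by apply/setP => j; rewrite !inE; case: eqVneq => // ->; rewrite iC.
rewrite !mxE !eqxx addr0 mulr1 /GRing.scale /=.
by field.
Qed.

(** The product of e_i and e_i^* is, up to the factor -2, the projection onto
    the span of the e_C with i in C. *)
Lemma ext_rho_number i s C :
  ext_rho R m (delta_mx 0 i, 0) (ext_rho R m (0, delta_mx 0 i) s) C =
  -2 * (i \in C)%:R * s C.
Proof.
have intE (x : ext R m) D : ext_rho R m (0, delta_mx 0 i) x D =
    if i \in D then 0 else -2 * (-1) ^+ inversions [set i] D * x (i |: D).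
  rewrite ext_rhoE /ext_rho_fun -scaleNr ffunE wedge_vecE big1 ?add0r => [|j _]; last first.
    by rewrite mxE mulr0 mul0r.
  rewrite ffunE [interior _ _ _]ffunE; case: ifP => iD.
    rewrite big1 ?scaler0 // => j jC.
    rewrite !mxE eqxx (_ : j == i = false) /= ?mulr0 ?mul0r //.
    by apply/negP => /eqP e; rewrite e iD in jC.
  rewrite (bigD1 i) ?iD //= big1 => [|j /andP[_ ji]]; last first.
    by rewrite !mxE eqxx (negPf ji) /= !mulr0 mul0r.
  by rewrite mxE !eqxx mulr1 addr0 /GRing.scale /= mulrA.
rewrite ext_rhoE /ext_rho_fun -scaleNr ffunE wedge_vecE ffunE [interior _ _ _]ffunE /=.
rewrite [X in _ *: X]big1 ?scaler0 ?addr0 => [|j _]; last first.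
  by rewrite mxE mulr0 mul0r.
case: (boolP (i \in C)) => iC; last first.
  rewrite mulr0 mul0r big1 // => j jC.
  rewrite mxE eqxx (_ : j == i = false) /= ?mulr0 ?mul0r //.
  by apply: contraNF iC => /eqP <-.
rewrite (bigD1 i) //= big1 ?addr0 => [|j /andP[_ ji]]; last first.
  by rewrite mxE eqxx (negPf ji) /= mulr0 mul0r.
rewrite mxE !eqxx !mulr1 intE !inE eqxx /= setD1K //.
transitivity (((-1) ^+ inversions [set i] (C :\ i)) ^+ 2 * (-2 * s C)); first by ring.
by rewrite sqrr_sign mul1r.
Qed.

End ExteriorGrading.

Section TensorTheory.
Variables (R : realType) (I : finType) (T : vectType R).
Local Notation S := {ffun I -> T}.

Lemma tens_end_mono (F : 'End({ffun I -> R^o})) (B : 'End(T)) (c : I -> R) (h : I -> I)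
    (x : S) i : (forall s j, F s j = c j * s (h j)) ->
  tens_end F B x i = c i *: B (x (h i)).
Proof.
move=> Fe; rewrite linfunE; last exact: tens_end_linear.
rewrite sum_ffunE (bigD1 (h i)) //= big1 => [|j ji].
  by rewrite !ffunE Fe ffunE eqxx mulr1 addr0.
by rewrite !ffunE Fe ffunE (negPf ji) mulr0 scale0r.
Qed.

Lemma tens_end_id (B : 'End(T)) (x : S) i :
  tens_end (\1%VF : 'End({ffun I -> R^o})) B x i = B (x i).
Proof.
have -> := @tens_end_mono \1%VF B (fun=> 1) id x i; first by rewrite scale1r.
by move=> s j; rewrite id_lfunE mul1r.
Qed.

Lemma tens_basisE (i j : I) (t : T) : tens (ffbasis R i) t j = (i == j)%:R *: t :> T.
Proof. by rewrite !ffunE. Qed.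

Lemma tens_end_comp (F G : 'End({ffun I -> R^o})) (A B : 'End(T)) :
  (tens_end F A \o tens_end G B)%VF = tens_end (F \o G)%VF (A \o B)%VF.
Proof. by apply: tens_lfunP => s t; rewrite !(comp_lfunE, tens_endE). Qed.

Lemma tens_endZ (F : 'End({ffun I -> R^o})) (A : 'End(T)) c :
  tens_end F (c *: A) = c *: tens_end F A.
Proof.
apply: tens_lfunP => s t; rewrite scale_lfunE !tens_endE scale_lfunE.
by apply/ffunP => i; rewrite !ffunE !scalerA mulrC.
Qed.

Lemma tens_mem (U1 : {vspace {ffun I -> R^o}}) (U2 : {vspace T}) s t :
  s \in U1 -> t \in U2 -> tens s t \in tens_space U1 U2.
Proof.
move=> sU tU; set M := tens_space _ _.
have lr (x : {ffun I -> R^o}) : linear (tens (T := T) x) by exact: tens_linearr.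
have ll y : linear ((@tens R I T)^~ y) by exact: tens_linearl.
have gen x : x \in vbasis U1 -> forall y, y \in U2 -> tens x y \in M.
  move=> xU y; rewrite -[in y \in _](span_basis (vbasisP U2)) => yU.
  have /subvP/(_ _ yU) : (<<vbasis U2>> <= linfun (tens x) @^-1: M)%VS.
    apply/span_subvP => z zU; rewrite -memv_preim linfunE //.
    by apply: memv_span; apply/allpairsP; exists (x, z).
  by rewrite -memv_preim linfunE.
rewrite -(span_basis (vbasisP U1)) in sU.
have /subvP/(_ _ sU) : (<<vbasis U1>> <= linfun ((@tens R I T)^~ t) @^-1: M)%VS.
  apply/span_subvP => z zU; rewrite -memv_preim linfunE //; exact: gen.
by rewrite -memv_preim linfunE.
Qed.

Lemma tens_space_sub (U1 : {vspace {ffun I -> R^o}}) (U2 : {vspace T}) (M : {vspace S}) :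
  (forall s t, s \in U1 -> t \in U2 -> tens s t \in M) -> (tens_space U1 U2 <= M)%VS.
Proof.
move=> sub; apply/span_subvP => _ /allpairsP[[x y] [/= xU yU ->]].
by apply: sub; apply: vbasis_mem.
Qed.

End TensorTheory.

(** * Operators on the tensor product *)

Section TensorClifford.
Variables (R : realType) (m : nat) (W2 S2 : vectType R).
Variable rho2 : 'Hom(W2, 'End(S2)).
Local Notation V1 := ('rV[R]_m * 'rV[R]_m)%type.
Local Notation S1 := {ffun {set 'I_m} -> R^o}.
Local Notation S := {ffun {set 'I_m} -> S2}.
Local Notation rho := (tens_rho m rho2).
Implicit Types (A B C : {set 'I_m}) (i : 'I_m) (x y : S).

Lemma tens_ind (P : S -> Prop) : (forall x y, P x -> P y -> P (x + y)) ->
  (forall s t, P (tens s t)) -> forall x, P x.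
Proof.
move=> PD Pt x; rewrite [x]tens_basis_sum; apply: big_ind => //.
by have := Pt 0 0; rewrite (_ : tens _ _ = 0) //; apply/ffunP => A; rewrite !ffunE scaler0.
Qed.

Lemma tens0l (t : S2) : tens (0 : S1) t = 0.
Proof. by apply/ffunP => A; rewrite !ffunE scale0r. Qed.

Lemma tens0r (s : S1) : tens s (0 : S2) = 0.
Proof. by apply/ffunP => A; rewrite !ffunE scaler0. Qed.

Lemma tensZl c (s : S1) (t : S2) : tens (c *: s) t = c *: tens s t.
Proof. by have := tens_linearl t c s 0; rewrite addr0 tens0l addr0. Qed.

Lemma tensZr c (s : S1) (t : S2) : tens s (c *: t) = c *: tens s t.
Proof. by have := tens_linearr s c t 0; rewrite addr0 tens0r addr0. Qed.

Lemma tensNl (s : S1) (t : S2) : tens (- s) t = - tens s t.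
Proof. by rewrite -scaleN1r tensZl scaleN1r. Qed.

Lemma tensNr (s : S1) (t : S2) : tens s (- t) = - tens s t.
Proof. by rewrite -scaleN1r tensZr scaleN1r. Qed.

Lemma tens_rho_lE v x : rho (v, 0) x = tens_end (ext_rho R m v) \1 x.
Proof.
move: x; apply: tens_ind => [x y ex ey|s t]; first by rewrite !linearD /= ex ey.
by rewrite tens_rhoE tens_endE id_lfunE /= linear0 zero_lfunE tens0r addr0.
Qed.

Lemma tens_rho_rE w x : rho (0, w) x = tens_end (ext_E R m) (rho2 w) x.
Proof.
move: x; apply: tens_ind => [x y ex ey|s t]; first by rewrite !linearD /= ex ey.
by rewrite tens_rhoE tens_endE /= linear0 zero_lfunE tens0l add0r.
Qed.

Lemma flip_lE i x C : tens_end (ext_rho R m (flip_vec R i)) \1 x C =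
  (-1) ^+ inversions [set i] (C :\ i) *: x (toggle i C).
Proof.
rewrite (@tens_end_mono _ _ _ _ _ (fun C => (-1) ^+ inversions [set i] (C :\ i)) (toggle i)).
  by rewrite id_lfunE.
by move=> s j; rewrite ext_rho_flip.
Qed.

Lemma number_lE i x C :
  tens_end (ext_rho R m (delta_mx 0 i, 0)) \1
    (tens_end (ext_rho R m (0, delta_mx 0 i)) \1 x) C = (-2 * (i \in C)%:R) *: x C.
Proof.
rewrite -comp_lfunE tens_end_comp.
rewrite (@tens_end_mono _ _ _ _ _ (fun C => -2 * (i \in C)%:R) id).
  by rewrite comp_lfunE !id_lfunE.
by move=> s j; rewrite comp_lfunE ext_rho_number.
Qed.

Lemma toggleK i C : toggle i (toggle i C) = C.
Proof.
rewrite /toggle; case: (boolP (i \in C)) => iC.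
  by rewrite !inE eqxx /= setD1K.
by rewrite setU11 setU1K.
Qed.

Lemma set_toggle_ind (P : {set 'I_m} -> Prop) :
  (forall i A, P A -> P (toggle i A)) -> forall A B, P A -> P B.
Proof.
move=> Pt; have P0 A : P A <-> P set0.
  have [n] := ubnP #|A|; elim: n A => // n IH A /ltnSE An.
  have [->//|[i iA]] := set_0Vmem A.
  have ti : toggle i A = A :\ i by rewrite /toggle iA.
  rewrite -(IH (A :\ i)); last by rewrite (cardsD1 i) iA in An.
  rewrite -ti; split; first exact: Pt.
  by move/(Pt i); rewrite toggleK.
by move=> A B PA; apply/(P0 B)/(P0 A).
Qed.

(** The commutant of the Clifford algebra of R^{m,m} acting on the first
    factor: the diagonal operators separate the lines of the e_A, and the flips
    identify the diagonal blocks with each other. *)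
Lemma commutant_ext (Z : 'End(S)) :
  (forall v x, Z (tens_end (ext_rho R m v) \1 x) = tens_end (ext_rho R m v) \1 (Z x)) ->
  exists B : 'End(S2), Z = tens_end \1 B.
Proof.
move=> cZ.
have diag A C t : A != C -> Z (tens (ffbasis R A) t) C = 0.
  move=> AC; have [i iAC] : exists i, (i \in A) != (i \in C).
    apply: contrapT => n; case/eqP: AC; apply/setP => i.
    by apply: contrapT => /eqP iAC; apply: n; exists i.
  have : Z (tens_end (ext_rho R m (delta_mx 0 i, 0)) \1
    (tens_end (ext_rho R m (0, delta_mx 0 i)) \1 (tens (ffbasis R A) t))) C =
    (-2 * (i \in C)%:R) *: Z (tens (ffbasis R A) t) C.
    by rewrite !cZ number_lE.
  have -> : tens_end (ext_rho R m (delta_mx 0 i, 0)) \1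
    (tens_end (ext_rho R m (0, delta_mx 0 i)) \1 (tens (ffbasis R A) t)) =
    (-2 * (i \in A)%:R) *: tens (ffbasis R A) t.
    apply/ffunP => D; rewrite number_lE [RHS]ffunE !tens_basisE.
    by case: eqVneq => [->//|_]; rewrite scale0r !scaler0.
  have N2 : (-2 : R) == 0 = false by rewrite oppr_eq0 pnatr_eq0.
  rewrite linearZ ffunE /=; case: (i \in A) (i \in C) iAC => -[] //= _.
    by rewrite mulr0 mulr1 scale0r => /eqP; rewrite scaler_eq0 N2 => /eqP.
  by rewrite mulr0 mulr1 scale0r => /esym/eqP; rewrite scaler_eq0 N2 => /eqP.
pose B0 := fun t => Z (tens (ffbasis R set0) t) set0.
have lB : linear B0.
  by move=> c s t; rewrite /B0 tens_linearr linearP !ffunE.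
exists (linfun B0); apply/lfunP => x.
have blk A t : Z (tens (ffbasis R A) t) A = B0 t.
  apply: (@set_toggle_ind (fun A => Z (tens (ffbasis R A) t) A = B0 t) _ set0) => // i {}A IH.
  have sg2 D : (-1) ^+ D * (-1) ^+ D = 1 :> R by rewrite -expr2 sqrr_sign.
  have : Z (tens_end (ext_rho R m (flip_vec R i)) \1 (tens (ffbasis R A) t)) (toggle i A) =
    (-1) ^+ inversions [set i] (toggle i A :\ i) *: B0 t.
    by rewrite cZ flip_lE toggleK IH.
  have -> : tens_end (ext_rho R m (flip_vec R i)) \1 (tens (ffbasis R A) t) =
    (-1) ^+ inversions [set i] (toggle i A :\ i) *: tens (ffbasis R (toggle i A)) t.
    apply/ffunP => D; rewrite flip_lE [RHS]ffunE !tens_basisE.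
    case: (eqVneq A (toggle i D)) => [->|ne]; first by rewrite toggleK eqxx.
    rewrite (_ : toggle i A == D = false) ?scale0r ?scaler0 //.
    by apply: contraNF ne => /eqP <-; rewrite toggleK.
  rewrite linearZ ffunE /= => /(congr1 ( *:%R ((-1) ^+ inversions [set i] (toggle i A :\ i)))).
  by rewrite !scalerA sg2 !scale1r.
apply/ffunP => C; rewrite tens_end_id linfunE //.
rewrite [in LHS](tens_basis_sum x) linear_sum sum_ffunE (bigD1 C) //= big1 => [|A AC].
  by rewrite addr0 blk.
exact: diag.
Qed.

(** Id for e = 1 and E for e = -1: the endomorphism of S_1 that commutes with
    Clifford multiplication up to the sign e. *)
Definition sign_end (e : R) : 'End(ext R m) := if e == 1 then \1%VF else ext_E R m.

Lemma sign_end1 : sign_end 1 = \1%VF. Proof. by rewrite /sign_end eqxx. Qed.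

Lemma sign_endN1 : sign_end (-1) = ext_E R m.
Proof. by rewrite /sign_end sign1N. Qed.

Lemma sign_end_rho e v s : is_sign e ->
  sign_end e (ext_rho R m v s) = e *: ext_rho R m v (sign_end e s).
Proof.
case=> ->; first by rewrite sign_end1 !id_lfunE scale1r.
by rewrite sign_endN1 ext_E_rho scaleN1r.
Qed.

Lemma sign_end_E e s : sign_end e (ext_E R m s) = ext_E R m (sign_end e s).
Proof. by rewrite /sign_end; case: ifP => //; rewrite !id_lfunE. Qed.

Lemma sign_endK e s : sign_end e (sign_end e s) = s.
Proof. by rewrite /sign_end; case: ifP => _; rewrite ?id_lfunE ?ext_E_sq. Qed.

Lemma sign_end0 e : sign_end e (ffbasis R set0) = ffbasis R set0.
Proof.
rewrite /sign_end; case: ifP => _; rewrite ?id_lfunE //.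
by rewrite (ext_E_basis R set0) cards0 scale1r.
Qed.

Lemma tens_sign_end_inj e (A B : 'End(S2)) :
  tens_end (sign_end e) A = tens_end (sign_end e) B -> A = B.
Proof.
move/lfunP => AB; apply/lfunP => t.
have /ffunP/(_ set0) := AB (tens (ffbasis R set0) t).
by rewrite !tens_endE sign_end0 !tens_basisE eqxx !scale1r.
Qed.

Lemma tens_end_tau e (A2 : 'End(S2)) : is_sign e ->
  end_tau_eq rho (tens_end (sign_end e) A2) e <-> end_tau_eq rho2 A2 e.
Proof.
move=> se; rewrite !end_tau_eqP; split=> [tA w t|tA v x].
  have /ffunP/(_ set0) := tA (0, w) (tens (ffbasis R set0) t).
  rewrite !tens_rho_rE !tens_endE sign_end_E sign_end0 (ext_E_basis R set0) cards0 expr0 scale1r.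
  by rewrite [RHS]ffunE !tens_basisE eqxx !scale1r.
move: x; apply: tens_ind => [x y ex ey|s t].
  by rewrite !linearD /= ex ey.
rewrite tens_rhoE linearD /= !tens_endE tens_rhoE sign_end_rho // sign_end_E tA.
by rewrite tensZl tensZr scalerDr.
Qed.

(** An endomorphism of S with tau = e splits off the factor Id or E. *)
Lemma tens_end_tau_inv e Z : is_sign e -> end_tau_eq rho Z e ->
  exists2 A2 : 'End(S2), Z = tens_end (sign_end e) A2 & end_tau_eq rho2 A2 e.
Proof.
move=> se tZ; have /end_tau_eqP tZ' := tZ.
have [|B eB] := @commutant_ext (tens_end (sign_end e) \1 \o Z)%VF.
  move=> v x; rewrite !comp_lfunE -!tens_rho_lE tZ' linearZ /= !tens_rho_lE.
  move: (Z x); apply: tens_ind => [a b ea eb|s t].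
    by rewrite !linearD /= ea eb.
  by rewrite !tens_endE sign_end_rho // tensZl scalerA is_sign_sqr // scale1r.
exists B.
  transitivity (tens_end (sign_end e) \1 \o (tens_end \1 B))%VF.
    rewrite -eB; apply/lfunP => x; rewrite !comp_lfunE.
    move: (Z x); apply: tens_ind => [a b ea eb|s t].
      by rewrite !linearD /= -ea -eb.
    by rewrite !tens_endE sign_endK !id_lfunE.
  by rewrite tens_end_comp comp_lfun1l comp_lfun1r.
apply/(tens_end_tau _ se); rewrite (_ : tens_end _ B = Z) //.
apply/lfunP => x; have /lfunP/(_ x) := eB; rewrite comp_lfunE.
move=> /(congr1 (tens_end (sign_end e) \1)).
rewrite -[tens_end _ _ (tens_end \1 B x)]comp_lfunE tens_end_comp comp_lfun1l comp_lfun1r => <-.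
move: (Z x); apply: tens_ind => [a b ea eb|s t].
  by rewrite !linearD /= ea eb.
by rewrite !tens_endE sign_endK !id_lfunE.
Qed.

End TensorClifford.

(** * Semispinors and reducibility over the even Clifford algebra *)

Section Semispinors.
Variables (R : realType) (W S : vectType R) (rho : 'Hom(W, 'End(S))).
Variables (Sp Sm : {vspace S}).
Implicit Types (N : {vspace S}).

Lemma cl0_stable2 N u v s : cl0_stable rho N -> s \in N -> rho u (rho v s) \in N.
Proof.
move=> st sN; have /subv_limgP := st [:: u; v] isT; move=> /(_ s sN).
by rewrite /= !comp_lfunE id_lfunE.
Qed.

Lemma cl0_stableP N : (forall u v s, s \in N -> rho u (rho v s) \in N) ->
  cl0_stable rho N.
Proof.
move=> st vs; have [n] := ubnP (size vs); elim: n vs => // n IH [|u [|v vs]] //=.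
  by move=> _ _; apply/subv_limgP => s sN; rewrite id_lfunE.
rewrite negbK !ltnS => /ltnW/IH{}IH /IH /subv_limgP sub.
by apply/subv_limgP => s sN; rewrite !comp_lfunE; apply/st/sub.
Qed.

Lemma grading_stable P : grading Sp Sm P ->
  (forall v s, P (rho v s) = - rho v (P s)) -> cl0_stable rho Sp.
Proof.
case=> _ Pp _ aP; apply: cl0_stableP => u v s /Pp e; apply/Pp.
by rewrite !aP linearN opprK e.
Qed.

(** The grading operator of a pair of semispinor modules anticommutes with the
    vectors, since Cl^1 exchanges S^+ and S^-. *)
Lemma semispinors_grading : semispinors rho Sp Sm ->
  exists2 P : 'End(S), grading Sp Sm P & forall v s, P (rho v s) = - rho v (P s).
Proof.
move=> [[_ stp _] [_ stm _] c1 full cap].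
pose P := (daddv_pi Sp Sm - daddv_pi Sm Sp)%VF.
have capC : (Sm :&: Sp)%VS = 0%VS by rewrite capvC.
have PE s : P s = daddv_pi Sp Sm s - daddv_pi Sm Sp s by rewrite add_lfunE opp_lfunE.
have dec s : daddv_pi Sp Sm s + daddv_pi Sm Sp s = s.
  by apply: daddv_pi_add => //; rewrite full memvf.
have pi0 (U V : {vspace S}) s : (U :&: V)%VS = 0%VS -> (V :&: U)%VS = 0%VS ->
    (U + V)%VS = fullv -> s \in U -> daddv_pi V U s = 0.
  move=> UV VU f sU; have := daddv_pi_add UV (w := s).
  rewrite f memvf => /(_ isT); rewrite (daddv_pi_id UV sU) => /eqP.
  by rewrite -subr_eq0 addrC addKr => /eqP.
have Pp s : s \in Sp -> P s = s.
  by move=> sp; rewrite PE daddv_pi_id // (pi0 Sp Sm) // subr0.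
have Pm s : s \in Sm -> P s = - s.
  move=> sm; rewrite PE (daddv_pi_id capC sm) (pi0 Sm Sp) ?sub0r //.
  by rewrite addvC.
have pm v s : s \in Sp -> rho v s \in Sm.
  move=> sp; have [/(_ (subvv _)) /(_ [:: v] isT) /subv_limgP h _] := c1 Sm.
  by have := h s sp; rewrite /= comp_lfunE id_lfunE.
have mp v s : s \in Sm -> rho v s \in Sp.
  move=> sm; have [_ h] := c1 (rho v @^-1: Sp)%VS.
  suff /h/subvP/(_ s sm) : forall vs, odd (size vs) ->
      (clifford_word rho vs @: Sp <= rho v @^-1: Sp)%VS by rewrite -memv_preim.
  move=> vs ov; apply/subv_limgP => t tp; rewrite -memv_preim.
  have ev : ~~ odd (size (v :: vs)) by rewrite /= negbK.
  have /subv_limgP/(_ t tp) := stp _ ev.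
  by rewrite /= comp_lfunE.
have gP : grading Sp Sm P.
  have fix_sum s : P s = s -> s \in Sp.
    move=> e; suff -> : s = daddv_pi Sp Sm s by exact: memv_pi.
    apply: double_inj; have := congr2 +%R (dec s) e.
    by rewrite PE addrACA subrr addr0.
  have fix_diff s : P s = - s -> s \in Sm.
    move=> e; suff -> : s = daddv_pi Sm Sp s by exact: memv_pi.
    apply: double_inj; have := congr2 (fun x y => x - y) (dec s) e.
    by rewrite /= PE opprK opprB [_ - _]addrC addrACA subrr add0r.
  split=> s.
  - rewrite [P s]PE linearB /= Pp ?memv_pi // Pm ?memv_pi // opprK.
    exact: dec.
  - by split; [exact: Pp | exact: fix_sum].
  by split; [exact: Pm | exact: fix_diff].
exists P => // v s.
rewrite -[in LHS](dec s) !linearD /= (Pm (rho v _)) ?pm ?memv_pi //.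
rewrite (Pp (rho v _)) ?mp ?memv_pi //.
by rewrite PE linearB opprB addrC.
Qed.

End Semispinors.

Section TensorGrading.
Variables (R : realType) (m : nat) (W2 S2 : vectType R).
Variable rho2 : 'Hom(W2, 'End(S2)).
Local Notation S1 := {ffun {set 'I_m} -> R^o}.
Local Notation S := {ffun {set 'I_m} -> S2}.
Local Notation rho := (tens_rho m rho2).
Implicit Types (U : {vspace S2}) (P : 'End(S2)).

(** Stated for the even part alone: the odd part is the even part for the
    exchanged pair and the grading -P. *)
Lemma tens_evenP Up Um P : grading Up Um P -> forall x : S,
  x \in tens_even m Up Um <-> tens_end (ext_E R m) P x = x.
Proof.
move=> [PP Pp Pm] x; have [EE Ep Em] := @ext_grading R m.
have EPx y A : tens_end (ext_E R m) P y A = (-1) ^+ #|A| *: P (y A).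
  rewrite (@tens_end_mono _ _ _ _ _ (fun A : {set 'I_m} => (-1) ^+ #|A|) id) //.
  by move=> s B; rewrite ext_EEc.
split=> [xe|e].
  have /subvP/(_ x xe) : (tens_even m Up Um <= lker (tens_end (ext_E R m) P - \1)%VF)%VS.
    rewrite subv_add; apply/andP; split; apply: tens_space_sub => s t;
        rewrite memv_ker add_lfunE opp_lfunE id_lfunE tens_endE.
      by move=> /Ep -> /Pp ->; rewrite subrr.
    by move=> /Em -> /Pm ->; rewrite tensNl tensNr opprK subrr.
  by rewrite memv_ker add_lfunE opp_lfunE id_lfunE subr_eq0 => /eqP.
rewrite [x]tens_basis_sum; apply: memv_suml => A _.
have /ffunP/(_ A) := e; rewrite EPx -signr_odd => eA.
have bas : ffbasis R A \in (if odd #|A| then ext_odd R m else ext_even R m).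
  have e1 := @ext_E_basis R m A; rewrite -signr_odd in e1.
  case: (odd #|A|) e1 => e1; [apply/Em | apply/Ep].
    by rewrite e1 scaleN1r.
  by rewrite e1 scale1r.
case: (odd #|A|) bas eA => bas; rewrite ?scaleN1r ?scale1r => eA.
  apply: (subvP (addvSr _ _)); apply: tens_mem => //; apply/Pm.
  by rewrite -[in RHS]eA opprK.
by apply: (subvP (addvSl _ _)); apply: tens_mem => //; apply/Pp.
Qed.

Lemma tens_grading Up Um P : grading Up Um P ->
  grading (tens_even m Up Um) (tens_odd m Up Um) (tens_end (ext_E R m) P).
Proof.
move=> gP; have [PP Pp Pm] := gP.
have gN : grading Um Up (- P).
  split=> s; rewrite ?opp_lfunE ?linearN /= ?opp_lfunE ?PP ?opprK //.
    by rewrite Pm; split=> [->|e]; rewrite ?opprK // -[in RHS]e opprK.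
  by rewrite Pp; split=> [->|/oppr_inj].
split=> x; [|exact: (tens_evenP gP)|].
  move: x; apply: tens_ind => [x y ex ey|s t]; first by rewrite !linearD /= ex ey.
  by rewrite !tens_endE ext_E_sq PP.
rewrite (tens_evenP gN) -scaleN1r tens_endZ scale_lfunE scaleN1r.
by split=> [e|->]; rewrite ?opprK // -[in RHS]e opprK.
Qed.

Lemma tens_end_anti P : (forall v t, P (rho2 v t) = - rho2 v (P t)) ->
  forall v x, tens_end (ext_E R m) P (rho v x) = - rho v (tens_end (ext_E R m) P x).
Proof.
move=> aP v x; move: x; apply: tens_ind => [x y ex ey|s t].
  by rewrite !linearD /= ex ey.
rewrite tens_rhoE linearD /= !tens_endE tens_rhoE ext_E_rho aP opprD.
by rewrite tensNl tensNr.
Qed.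

Variable g : W2 -> W2 -> R.
Hypothesis cl : clifford_module g rho2.
Variable w : W2.
Hypothesis gw : g w w != 0.

(** A Cl^0(V)-submodule N contains e_A (x) x_A for each of its elements x. The
    t with e_A (x) t in N form a Cl^0(V_2)-submodule, and the products of a flip
    with a vector of V_2 carry it from A to its neighbours. *)
Lemma tens_irreducible : irreducible (cl0_stable rho2) fullv ->
  irreducible (cl0_stable rho) (fullv : {vspace S}).
Proof.
move=> [full0 _ min]; split.
- apply: contra full0; rewrite -!subv0 => /subvP sub; apply/subvP => t _.
  have := sub (tens (ffbasis R set0) t) (memvf _).
  rewrite !memv0 => /eqP/ffunP/(_ set0); rewrite tens_basisE eqxx scale1r ffunE.
  by move=> ->.
- by move=> vs _; apply: subvf.
move=> N _ stN; have [->|N0] := eqVneq N 0%VS; [by left | right].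
have st u v x : x \in N -> rho u (rho v x) \in N by exact: cl0_stable2.
(* The product of e_i and e_i^* projects, up to a factor, onto the coordinates
   in the sets that contain i. *)
have restr1 i (b : bool) (x : S) : x \in N ->
    [ffun C : {set 'I_m} => if (i \in C) == b then x C else 0] \in N.
  move=> xN; have := st (delta_mx 0 i, 0, 0) (0, delta_mx 0 i, 0) x xN.
  rewrite !tens_rho_lE => nN.
  have eqt : [ffun C : {set 'I_m} => if i \in C then x C else 0] =
     - 2^-1 *: tens_end (ext_rho R m (delta_mx 0 i, 0)) \1
         (tens_end (ext_rho R m (0, delta_mx 0 i)) \1 x).
    apply/ffunP => C; rewrite [LHS]ffunE [RHS]ffunE number_lE scalerA.
    case: (i \in C); last by rewrite !mulr0 scale0r.
    by rewrite mulr1 mulrNN mulVf ?scale1r // pnatr_eq0.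
  case: b.
    rewrite (_ : [ffun _ => _] = [ffun C : {set 'I_m} => if i \in C then x C else 0]).
      by rewrite eqt memvZ.
    by apply/ffunP => C; rewrite !ffunE; case: (i \in C).
  rewrite (_ : [ffun _ => _] = x - [ffun C : {set 'I_m} => if i \in C then x C else 0]).
    by rewrite eqt memvB // memvZ.
  by apply/ffunP => C; rewrite !ffunE; case: (i \in C); rewrite ?subrr ?subr0.
have coordN (x : S) A : x \in N -> tens (ffbasis R A) (x A) \in N.
  move=> xN; have restr (s : seq 'I_m) :
      [ffun C : {set 'I_m} => if all (fun i => (i \in C) == (i \in A)) s then x C else 0] \in N.
    elim: s => [|i s IH].
      by rewrite (_ : [ffun _ => _] = x) //; apply/ffunP => C; rewrite ffunE.
    rewrite (_ : [ffun _ => _] = [ffun C : {set 'I_m} => if (i \in C) == (i \in A) then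
      [ffun C : {set 'I_m} => if all (fun i => (i \in C) == (i \in A)) s then x C else 0] C else 0]).
      exact: restr1.
    by apply/ffunP => C; rewrite !ffunE /=; case: (_ == _).
  rewrite (_ : tens _ _ = [ffun C : {set 'I_m} => if all (fun i => (i \in C) == (i \in A)) (enum 'I_m) then x C else 0]) //.
  apply/ffunP => C; rewrite tens_basisE ffunE.
  case: (eqVneq A C) => [->|AC].
    by rewrite scale1r; case: allP => // -[] i _.
  rewrite scale0r; case: allP => // CA; case/eqP: AC; apply/setP => i.
  by have /eqP -> := CA i (mem_enum _ _).
have [A [t [t0 tN]]] : exists A, exists t : S2, t != 0 /\ tens (ffbasis R A) t \in N.
  have p0 : vpick N != 0 by rewrite vpick0.
  have [A pA] : exists A, vpick N A != 0.
    apply: contrapT => n; case/eqP: p0; apply/ffunP => A; rewrite [RHS]ffunE.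
    by apply: contrapT => /eqP pA; apply: n; exists A.
  by exists A, (vpick N A); split=> //; apply/coordN/memv_pick.
have linb B : linear (tens (T := S2) (ffbasis R (B : {set 'I_m}))) by exact: tens_linearr.
(* E squares to 1, so products of two vectors of V_2 act on the second factor
   alone. *)
pose M := (linfun (tens (T := S2) (ffbasis R A)) @^-1: N)%VS.
have EEb (B : {set 'I_m}) : ext_E R m (ext_E R m (ffbasis R B)) = ffbasis R B by exact: ext_E_sq.
have stM : cl0_stable rho2 M.
  apply: cl0_stableP => u v y; rewrite -!memv_preim !linfunE // => yN.
  have := st (0, u) (0, v) _ yN.
  by rewrite !tens_rho_rE !tens_endE EEb.
have fullA y : tens (ffbasis R A) y \in N.
  have [M0|MF] := min M (subvf _) stM; last first.
    by rewrite -(linfunE (linb A)) memv_preim -/M MF memvf.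
  have : t \in M by rewrite -memv_preim linfunE.
  by rewrite M0 memv0 (negPf t0).
have fullB B y : tens (ffbasis R B) y \in N.
  move: y; apply: (@set_toggle_ind m (fun B => forall y, tens (ffbasis R B) y \in N) _ A) => // i C IH y.
  rewrite [y](clifford_inv cl gw); set z := rho2 w y.
  have := st (flip_vec R i, 0) (0, w) _ (IH z).
  rewrite tens_rho_rE tens_endE tens_rho_lE (ext_E_basis R C) tensZl linearZ /=.
  have -> : tens_end (ext_rho R m (flip_vec R i)) \1 (tens (ffbasis R C) (rho2 w z)) =
    (-1) ^+ inversions [set i] (toggle i C :\ i) *: tens (ffbasis R (toggle i C)) (rho2 w z).
    apply/ffunP => D; rewrite flip_lE [RHS]ffunE !tens_basisE.
    case: (eqVneq C (toggle i D)) => [->|ne]; first by rewrite toggleK eqxx.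
    rewrite (_ : toggle i C == D = false) ?scale0r ?scaler0 //.
    by apply: contraNF ne => /eqP <-; rewrite toggleK.
  rewrite scalerA -exprD tensZr => /(memvZ ((-1) ^+ (#|C| + inversions [set i] (toggle i C :\ i)))).
  rewrite scalerA -expr2 sqrr_sign scale1r; exact: memvZ.
apply/vspaceP => x; rewrite memvf [x]tens_basis_sum.
by apply: memv_suml => B _.
Qed.

Lemma tens_cl0_reducible (S2p S2m : {vspace S2}) :
  (cl0_reducible rho2 -> semispinors rho2 S2p S2m) ->
  cl0_reducible rho2 <-> cl0_reducible rho.
Proof.
move=> ss; split=> [red irr|red irr]; last exact/red/tens_irreducible.
have sm := ss red; have [[p0 _ _] [m0 _ _] _ _ _] := sm.
have [P gP aP] := semispinors_grading sm.
have [PP Pp Pm] := gP.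
have [PP' Pp' Pm'] := tens_grading gP.
have [_ _ min] := irr.
have [] := min (tens_even m S2p S2m) (subvf _) (grading_stable (tens_grading gP) (tens_end_anti aP)).
  move=> e0; have : tens (ffbasis R set0) (vpick S2p) \in tens_even m S2p S2m.
    apply/Pp'; rewrite tens_endE (ext_E_basis R set0) cards0 scale1r.
    by have /Pp -> := memv_pick S2p.
  rewrite e0 memv0 => /eqP/ffunP/(_ set0); rewrite tens_basisE eqxx scale1r ffunE.
  by apply/eqP; rewrite vpick0.
move=> eF; have /Pp' : tens (ffbasis R set0) (vpick S2m) \in tens_even m S2p S2m.
  by rewrite eF memvf.
rewrite tens_endE (ext_E_basis R set0) cards0 scale1r; have /Pm -> := memv_pick S2m.
move=> /ffunP/(_ set0); rewrite !tens_basisE eqxx !scale1r => /esym/eq_oppr0.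
by apply/eqP; rewrite vpick0.
Qed.

End TensorGrading.

(** * Semispinors are orthogonal for the invariant scalar product *)

Section SymmetricEigenvalue.
Variables (R : realType) (S : vectType R) (h : bilform S) (B : 'End(S)).
Hypothesis hpos : forall s, s != 0 -> 0 < h s s.
Hypothesis Bsym : forall s t, h (B s) t = h s (B t).

(** If x + i y is an eigenvector of the complexification of B for the
    eigenvalue a + i c, then c = 0, so x and y are eigenvectors of B unless they
    vanish. *)
Lemma symmetric_plane (a c : R) x y : (x != 0) || (y != 0) ->
  B x = a *: x - c *: y -> B y = c *: x + a *: y ->
  exists2 s, s != 0 & B s = a *: s.
Proof.
move=> xy Bx By.
have hge s : 0 <= h s s.
  by have [->|/hpos/ltW//] := eqVneq s 0; rewrite linear0 lexx.
have n0 : h x x + h y y != 0.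
  apply/lt0r_neq0; case/orP: xy => /hpos p; [exact: ltr_pwDl | exact: ltr_wpDl].
have c0 : c = 0.
  have := Bsym x y; rewrite Bx By !(formDl, formDr, formNl, formNr, formZl, formZr) => e.
  have /eqP : c * (h x x + h y y) = 0.
    by apply/eqP; rewrite mulrDr; apply/eqP; move: e; move: (h x x) (h y y) (h x y) => p q r; lra.
  by rewrite mulf_eq0 (negPf n0) orbF => /eqP.
case/orP: xy => n; [exists x => //|exists y => //].
  by rewrite Bx c0 scale0r subr0.
by rewrite By c0 scale0r add0r.
Qed.

Lemma symmetric_eigenvector : (fullv : {vspace S}) != 0%VS ->
  exists a : R, exists2 s, s != 0 & B s = a *: s.
Proof.
rewrite -dimv_eq0; set n := \dim _ => n0.
pose X := vbasis (fullv : {vspace S}).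
pose M : 'M[R]_n := \matrix_(i, j) coord X j (B X`_i).
pose vec (u : 'rV[R]_n) : S := \sum_i u 0 i *: X`_i.
have Bvec u : B (vec u) = vec (u *m M).
  rewrite /vec linear_sum; under eq_bigr => i _.
    rewrite linearZ /= (coord_vbasis (memvf (B X`_i))) scaler_sumr; over.
  rewrite exchange_big /=; apply: eq_bigr => j _.
  rewrite mxE scaler_suml; apply: eq_bigr => i _.
  by rewrite mxE scalerA.
(* Only the action of M on coordinates matters below. *)
clearbody M.
have vec_inj u : vec u = 0 -> u = 0.
  move=> e; apply/rowP => i; rewrite mxE.
  have /freeP fX : free X by exact: basis_free (vbasisP _).
  exact: (fX (fun i => u 0 i) e i).
pose MC := map_mx (real_complex R) M.
have [z rz] : exists z, root (char_poly MC) z.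
  by apply/closed_rootP; rewrite size_char_poly.
move: rz; rewrite -eigenvalue_root_char => /eigenvalueP[w wM w0].
have ReD (p q : R[i]) : complex.Re (p + q) = complex.Re p + complex.Re q by case: p; case: q.
have ImD (p q : R[i]) : complex.Im (p + q) = complex.Im p + complex.Im q by case: p; case: q.
pose x := map_mx (@complex.Re R) w; pose y := map_mx (@complex.Im R) w.
have wMj j : \sum_i w 0 i * (real_complex R) (M i j) = z * w 0 j.
  have /rowP/(_ j) := wM; rewrite !mxE => <-.
  by apply: eq_bigr => i _; rewrite mxE.
have xM : x *m M = complex.Re z *: x - complex.Im z *: y.
  apply/rowP => j; rewrite !mxE; have := congr1 (@complex.Re R) (wMj j).
  rewrite (big_morph (@complex.Re R) ReD (erefl _)) => e.
  transitivity (complex.Re (z * w 0 j)); last by case: (z) => ? ?; case: (w 0 j).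
  rewrite -e; apply: eq_bigr => i _; rewrite mxE; case: (w 0 i) => p q /=.
  by rewrite mulr0 subr0.
have yM : y *m M = complex.Im z *: x + complex.Re z *: y.
  apply/rowP => j; rewrite !mxE; have := congr1 (@complex.Im R) (wMj j).
  rewrite (big_morph (@complex.Im R) ImD (erefl _)) => e.
  transitivity (complex.Im (z * w 0 j)).
    rewrite -e; apply: eq_bigr => i _; rewrite mxE; case: (w 0 i) => p q /=.
    by rewrite mulr0 add0r.
  by case: (z) => ? ?; case: (w 0 j) => ? ? /=; rewrite addrC.
exists (complex.Re z); apply: (@symmetric_plane _ (complex.Im z) (vec x) (vec y)).
- rewrite -negb_and; apply: contra w0 => /andP[/eqP/vec_inj x0 /eqP/vec_inj y0].
  apply/eqP/rowP => i; rewrite mxE.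
  have /rowP/(_ i) := x0; have /rowP/(_ i) := y0; rewrite !mxE.
  by case: (w 0 i) => p q /= -> ->.
- rewrite Bvec xM /vec !scaler_sumr -sumrB; apply: eq_bigr => i _.
  by rewrite !mxE scalerBl !scalerA.
rewrite Bvec yM /vec !scaler_sumr -big_split; apply: eq_bigr => i _ /=.
by rewrite !mxE scalerDl !scalerA.
Qed.

End SymmetricEigenvalue.

Section TauLinear.
Variables (R : realType) (W S : vectType R) (rho : 'Hom(W, 'End(S))) (e : R).
Implicit Types (A B : 'End(S)).

Lemma end_tauD A B : end_tau_eq rho A e -> end_tau_eq rho B e ->
  end_tau_eq rho (A + B) e.
Proof. by move=> tA tB v; rewrite comp_lfunDl comp_lfunDr scalerDr tA tB. Qed.

Lemma end_tauZ c A : end_tau_eq rho A e -> end_tau_eq rho (c *: A) e.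
Proof.
by move=> tA v; rewrite -comp_lfunZl -comp_lfunZr tA !scalerA mulrC.
Qed.

Lemma end_tauN A : end_tau_eq rho A e -> end_tau_eq rho (- A) e.
Proof. by rewrite -scaleN1r; apply: end_tauZ. Qed.

End TauLinear.

Section ScalarProduct.
Variables (R : realType) (W S : vectType R) (rho : 'Hom(W, 'End(S))).
Variables (h : bilform S) (d : R).
Hypothesis hsym : forall s t, h s t = h t s.
Hypothesis hpos : forall s, s != 0 -> 0 < h s s.
Hypotheses (sd : is_sign d) (th : form_tau_eq rho h d).

Lemma scalar_product_nondeg : nondegenerate h.
Proof.
move=> s s0; apply/eqP; apply: contraT => /hpos; by rewrite s0 ltxx.
Qed.

(** The form h(A -, B -) is h(C -, -) for some C. With A = Id this gives the
    adjoint of B. *)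
Lemma pullback_rep (A B : 'End(S)) :
  exists C : 'End(S), forall s t, h (C s) t = h (A s) (B t).
Proof.
pose c := bilinfun (fun s t => h (A s) (B t)).
have cE s t : c s t = h (A s) (B t).
  apply: bilinfunE => [x a y z|x a y z].
    by rewrite linearP /= formDr formZr.
  by rewrite linearP /= formDl formZl.
exists (h^-1 \o c)%VF => s t.
by rewrite -cE -form_compE (nondeg_compVK scalar_product_nondeg).
Qed.

(** An involution that anticommutes with Clifford multiplication is an isometry:
    the form h(P -, P -) is represented by a positive symmetric operator in the
    commutant of an irreducible module, which is a scalar, necessarily 1. *)
Lemma anti_involution_isometry (P : 'End(S)) : irreducible (cl_stable rho) fullv ->
  (forall s, P (P s) = s) -> (forall v s, P (rho v s) = - rho v (P s)) ->
  form_iota_eq P h 1.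
Proof.
move=> [full0 _ min] PP aP.
have [B hB] := pullback_rep P P.
have Bsym s t : h (B s) t = h s (B t) by rewrite [RHS]hsym !hB hsym.
have Bv v s : B (rho v s) = rho v (B s).
  apply: (nondeg_inj scalar_product_nondeg) => t.
  by rewrite hB aP formNl th th hB aP formNr mulrN.
have [a [x x0 Bx]] := symmetric_eigenvector hpos Bsym full0.
have kerF : lker (B - a *: \1)%VF = fullv.
  have [||] // := min (lker (B - a *: \1)%VF) (subvf _).
    elim=> [|v vs IH]; apply/subv_limgP => s sN /=; first by rewrite id_lfunE.
    have /subv_limgP/(_ s sN) := IH.
    rewrite comp_lfunE !memv_ker !(add_lfunE, opp_lfunE, scale_lfunE, id_lfunE).
    by rewrite !subr_eq0 Bv => /eqP ->; rewrite linearZ.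
  move=> k0; have : x \in lker (B - a *: \1)%VF.
    by rewrite memv_ker !(add_lfunE, opp_lfunE, scale_lfunE, id_lfunE) Bx subrr.
  by rewrite k0 memv0 (negPf x0).
have BE s : B s = a *: s.
  have : s \in lker (B - a *: \1)%VF by rewrite kerF memvf.
  by rewrite memv_ker !(add_lfunE, opp_lfunE, scale_lfunE, id_lfunE) subr_eq0 => /eqP.
have hP s t : h (P s) (P t) = a * h s t by rewrite -hB BE formZl.
have Px0 : P x != 0 by apply: contra x0 => /eqP e; rewrite -[x]PP e linear0.
have hx := hpos x0; have hPx := hpos Px0.
have a0 : 0 < a by move: hPx; rewrite hP pmulr_lgt0.
have : a * a = 1.
  have := hP (P x) (P x); rewrite !PP hP mulrA => e.
  by apply: (mulIf (lt0r_neq0 hx)); rewrite mul1r -e.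
move/eqP; rewrite -expr2 sqrf_eq1 => /orP[/eqP a1|/eqP aN] s t; rewrite hP ?a1 //.
by move: a0; rewrite aN; lra.
Qed.

Variables (Sp Sm : {vspace S}) (P : 'End(S)).
Hypothesis gP : cl0_reducible rho -> [/\ grading Sp Sm P,
  forall v s, P (rho v s) = - rho v (P s) & form_iota_eq P h 1].

Variable g : W -> W -> R.
Variable w : W.
Hypotheses (cl : clifford_module g rho) (gw : g w w != 0).

(** The commutant of the even Clifford algebra is spanned by admissible
    endomorphisms: conjugation by an anisotropic vector, the adjoint and
    conjugation by P are commuting involutions of it. *)
Lemma schur_admissible_ind (D : 'End(S) -> Prop) :
  (forall A B, D A -> D B -> D (A + B)) -> D 0 ->
  (forall A, schur rho A -> adm_end rho Sp Sm h A -> D A) ->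
  forall A, schur rho A -> D A.
Proof.
move=> DD D0 Dadm.
have step1 A e c : is_sign e -> is_sign c -> end_tau_eq rho A e -> end_sigma_eq h A c ->
    (cl0_reducible rho -> exists2 i, is_sign i & end_iota_eq P A i) -> D A.
  move=> se sc tA sA iA; have [->//|A0] := eqVneq A 0.
  apply: Dadm; first exact: (end_tau_schur cl se).
  split=> //; [by exists e | by exists c |].
  move=> red; have [gr _ _] := gP red.
  by apply/(exists_signE (end_evenE gr A) (end_oddE gr A)); exact: iA.
have step2 A e c : is_sign e -> is_sign c -> end_tau_eq rho A e -> end_sigma_eq h A c -> D A.
  move=> se sc tA sA; have [red|nred] := pselect (cl0_reducible rho); last first.
    exact: (step1 A e c se sc tA sA).
  have [[PP _ _] aP iP] := gP red.
  have Padj s t : h (P s) t = h s (P t) by have := iP s (P t); rewrite PP mul1r.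
  pose B := (P \o A \o P)%VF.
  have BE s : B s = P (A (P s)) by rewrite !comp_lfunE.
  have tAP := (end_tau_eqP rho A e).1 tA.
  have tB v s : B (rho v s) = e *: rho v (B s).
    by rewrite !BE aP !linearN /= tAP linearZ /= aP scalerN opprK.
  have sB s t : h (B s) t = c * h s (B t) by rewrite !BE Padj sA Padj.
  rewrite [A](half_sum A B); apply: DD.
    apply: (step1 _ e c se sc).
    - exact/end_tauZ/end_tauD/end_tau_eqP.
    - move=> s t; rewrite !scale_lfunE !add_lfunE !(formZl, formZr, formDl, formDr).
      by rewrite sA sB -mulrDr mulrCA.
    exists 1; first by left.
    move=> s; rewrite !scale_lfunE !add_lfunE scale1r !BE linearZ /= linearD /= !PP.
    by rewrite addrC.
  apply: (step1 _ e c se sc).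
  - exact/end_tauZ/end_tauD/end_tauN/end_tau_eqP.
  - move=> s t; rewrite !scale_lfunE !(add_lfunE, opp_lfunE) !(formZl, formZr, formDl, formDr, formNl, formNr).
    by rewrite sA sB -mulrBr mulrCA.
  exists (-1); first by right.
  move=> s; rewrite !scale_lfunE !(add_lfunE, opp_lfunE) scaleN1r !BE linearZ /= linearB /= !PP.
  by rewrite -scalerN opprB.
have step3 A e : is_sign e -> end_tau_eq rho A e -> D A.
  move=> se tA; have tAP := (end_tau_eqP rho A e).1 tA.
  have [B hB] := pullback_rep \1%VF A.
  have {}hB s t : h (B s) t = h s (A t) by rewrite hB id_lfunE.
  have tB v s : B (rho v s) = e *: rho v (B s).
    apply: (nondeg_inj scalar_product_nondeg) => t.
    by rewrite hB th formZl th hB tAP formZr mulrCA (mulrCA e) sign_mulI.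
  have hB' s t : h s (B t) = h (A s) t by rewrite hsym hB hsym.
  rewrite [A](half_sum A B); apply: DD.
    apply: (step2 _ e 1 se); first by left.
      exact/end_tauZ/end_tauD/end_tau_eqP.
    move=> s t; rewrite !scale_lfunE !add_lfunE !(formZl, formZr, formDl, formDr).
    by rewrite hB hB' mul1r addrC.
  apply: (step2 _ e (-1) se); first by right.
    exact/end_tauZ/end_tauD/end_tauN/end_tau_eqP.
  move=> s t; rewrite !scale_lfunE !(add_lfunE, opp_lfunE) !(formZl, formZr, formDl, formDr, formNl, formNr).
  by rewrite hB hB' mulN1r -mulrN opprB.
move=> A sA; rewrite [A](half_sum A (twist rho g w A)).
have [t1 tN] := twist_split cl gw sA.
by apply: DD; [apply: step3 t1; left | apply: step3 tN; right].
Qed.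

End ScalarProduct.

Section DefiniteModules.
Variables (R : realType) (k : nat) (neg : bool) (S : vectType R).
Variable rho : 'Hom('rV[R]_k, 'End(S)).
Variable h : bilform S.
Local Notation g := (@definite_form R k neg).
Hypothesis cl : clifford_module g rho.
Hypothesis ih : invariant_scalar_product g rho h.

Lemma definite_delta i : g (delta_mx 0 i) (delta_mx 0 i) = (-1) ^+ neg.
Proof.
rewrite /definite_form (bigD1 i) //= big1 => [|j ji].
  by rewrite mxE !eqxx mulr1 addr0 mulr1.
by rewrite mxE eqxx (negPf ji) mul0r.
Qed.

Lemma scalar_product_tau : form_tau_eq rho h (- (-1) ^+ neg).
Proof.
have [_ _ inv] := ih; move=> v s t.
have delta i : h (rho (delta_mx 0 i) s) t = - (-1) ^+ neg * h s (rho (delta_mx 0 i) t).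
  rewrite -(inv (delta_mx 0 i) s); last by rewrite definite_delta normrX normrN1 expr1n.
  rewrite (clifford_sq cl) definite_delta formZr mulrA mulrNN.
  by rewrite -expr2 sqrr_sign mul1r.
rewrite [v]row_sum_delta !linear_sum !sum_lfunE !linear_sum sum_lfunE mulr_sumr.
apply: eq_bigr => i _.
by rewrite !linearZ /= !scale_lfunE formZl formZr delta mulrCA.
Qed.

End DefiniteModules.

(** * The forms f and f_E and their invariants *)

Section SignForms.
Variables (R : realType) (m : nat) (vol : ext R m).
Hypotheses (m_gt0 : (0 < m)%N) (volm : ext_deg m vol) (vol0 : vol != 0).
Local Notation rho1 := (ext_rho R m).
Local Notation E := (ext_E R m).
Local Notation sign_end := (@sign_end R m).

(** f for e = 1 and f_E for e = -1. *)
Definition sign_form (e : R) : bilform (ext R m) := (ext_form vol \o sign_end e)%VF.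

(** The sign in h_1(A_1 s, t) = +- h_1(s, A_1 t) for A_1 = Id and A_1 = E. *)
Definition adj_sign (e : R) : R := if e == 1 then 1 else (-1) ^+ m.

Lemma adj_sign1 : adj_sign 1 = 1. Proof. by rewrite /adj_sign eqxx. Qed.

Lemma adj_signN1 : adj_sign (-1) = (-1) ^+ m.
Proof. by rewrite /adj_sign sign1N. Qed.

Lemma adj_sign_sign e : is_sign (adj_sign e).
Proof. by rewrite /adj_sign; case: ifP => _; [left | exact: is_sign_exp]. Qed.

Lemma sign_formP b : (b = ext_form vol \/ b = ext_form_E vol) <->
  (exists2 e, is_sign e & b = sign_form e).
Proof.
have f1 : sign_form 1 = ext_form vol by rewrite /sign_form sign_end1 comp_lfun1r.
have fN : sign_form (-1) = ext_form_E vol by rewrite /sign_form sign_endN1.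
split=> [[->|->]|[e [->|->] ->]]; rewrite ?f1 ?fN; [exists 1|exists (-1)|left|right] => //.
  by left. 
by right.
Qed.

Lemma sign_endM e c : is_sign e -> is_sign c -> (sign_end e \o sign_end c)%VF = sign_end (e * c).
Proof.
case=> ->; case=> ->; rewrite ?mul1r ?mulr1 ?mulrNN ?mulr1 ?sign_end1 ?comp_lfun1l ?comp_lfun1r //.
by apply/lfunP => s; rewrite comp_lfunE sign_endK id_lfunE.
Qed.

Lemma sign_form_comp e c : is_sign e -> is_sign c ->
  (sign_form e \o sign_end c)%VF = sign_form (e * c).
Proof. by move=> se sc; rewrite /sign_form -comp_lfunA sign_endM. Qed.

Lemma sign_end_neq0 e : sign_end e != 0.
Proof.
apply/eqP => /lfunP/(_ (ffbasis R set0)); rewrite sign_end0 zero_lfunE => /ffunP/(_ set0).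
by rewrite !ffunE eqxx; apply/eqP; rewrite oner_eq0.
Qed.

Lemma sign_form_nondeg e : nondegenerate (sign_form e).
Proof.
move=> s s0; rewrite -(sign_endK e s) [X in sign_end e X](_ : _ = 0) ?linear0 //.
by apply: (ext_form_nondeg volm vol0) => t; rewrite -form_compE s0.
Qed.

Lemma sign_form_neq0 e : sign_form e != 0.
Proof.
apply/nondeg_comp_neq0; first exact: ext_form_nondeg.
exact: sign_end_neq0.
Qed.

Lemma sign_end_tau e : is_sign e -> end_tau_eq rho1 (sign_end e) e.
Proof. by move=> se; apply/end_tau_eqP => v s; exact: sign_end_rho. Qed.

Lemma sign_form_tau e : is_sign e -> form_tau_eq rho1 (sign_form e) (- e).
Proof.
move=> se; rewrite -mulN1r; apply/form_tau_comp; first exact: ext_form_nondeg.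
- by right.
- exact: ext_form_tau.
exact: sign_end_tau.
Qed.

Lemma sign_end_iota e : end_iota_eq E (sign_end e) 1.
Proof. by move=> s; rewrite scale1r sign_end_E. Qed.

Lemma sign_form_iota e : form_iota_eq E (sign_form e) ((-1) ^+ m).
Proof.
move=> s t; rewrite -[_ ^+ m]mulr1.
apply: (form_iota_comp (sign_end e) (ext_form_nondeg volm vol0) _ _ _ _).2 => //.
- exact: ext_E_sq.
- exact: is_sign_exp.
- by left.
- exact: ext_form_iota.
exact: sign_end_iota.
Qed.

Lemma form_iota_adj (b : bilform (ext R m)) (P : 'End(ext R m)) c : (forall s, P (P s) = s) -> form_iota_eq P b c ->
  forall s t : ext R m, b (P s) t = c * b s (P t).
Proof. by move=> PP ib s t; have := ib s (P t); rewrite PP. Qed.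

Lemma sign_form_E e s t : sign_form e (E s) t = (-1) ^+ m * sign_form e s (E t).
Proof.
apply: form_iota_adj; first exact: ext_E_sq.
exact: sign_form_iota.
Qed.

Lemma sign_end_sigma e c : is_sign c ->
  end_sigma_eq (sign_form e) (sign_end c) (adj_sign c).
Proof.
move=> [->|->] s t; first by rewrite adj_sign1 sign_end1 !id_lfunE mul1r.
by rewrite adj_signN1 sign_endN1 sign_form_E.
Qed.

Lemma sign_form_sigma e : is_sign e ->
  form_sigma_eq (sign_form e) ((-1) ^+ (m * m.+1)./2 * adj_sign e).
Proof.
move=> se; apply/form_sigma_comp; first exact: is_sign_exp.
  exact: ext_form_sigma.
have := @sign_end_sigma 1 e se; rewrite /sign_form sign_end1 comp_lfun1r.
by [].
Qed.

(** Pairing with a suitable basis vector is, up to a nonzero factor, the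
    coordinate on e_A. *)
Lemma sign_form_dual e A : exists s', exists2 c : R, c != 0 &
  forall s, sign_form e s s' = c * s A.
Proof.
pose c : R := if e == 1 then 1 else (-1) ^+ #|A|.
have cE s : sign_end e s A = c * s A.
  by rewrite /sign_end /c; case: ifP; rewrite ?id_lfunE ?mul1r ?ext_EEc.
exists (ffbasis R (~: A)), (ext_coef R A / vol [set: 'I_m] * c) => [|s].
  rewrite mulf_neq0 //; first by rewrite mulf_neq0 ?ext_coef_neq0 ?invr_eq0 ?vol_top.
  by rewrite /c; case: ifP; rewrite ?oner_eq0 ?signr_eq0.
by rewrite form_compE ext_form_dual cE mulrA.
Qed.

Lemma flip_vec_norm (i : 'I_m) : neutral_form (flip_vec R i) (flip_vec R i) != 0.
Proof.
rewrite /neutral_form (bigD1 i) //= big1 => [|j ji]; last first.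
  by rewrite !mxE eqxx (negPf ji) /= !mul0r addr0.
rewrite !mxE !eqxx !mulr1 addr0 !mul1r -opprD oppr_eq0 -mulr2n mulrn_eq0 /= invr_eq0.
by rewrite pnatr_eq0.
Qed.

Lemma sign_end_tauE e : is_sign e -> end_tau rho1 (sign_end e) = e.
Proof.
move=> se; apply: (end_tauE (@ext_rho_clifford R m) (flip_vec_norm (Ordinal m_gt0))) => //.
  exact: sign_end_neq0.
exact: sign_end_tau.
Qed.

Lemma sign_end_iotaE e : end_iota (ext_even R m) (ext_odd R m) (sign_end e) = 1.
Proof.
apply: (end_iotaE (@ext_grading R m)); [exact: sign_end_neq0 | by left |].
exact: sign_end_iota.
Qed.

Lemma sign_end_sigmaE e c : is_sign c ->
  end_sigma (sign_form e) (sign_end c) = adj_sign c.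
Proof.
move=> sc; apply: end_sigmaE; first exact: sign_form_nondeg.
- exact: sign_end_neq0.
- exact: adj_sign_sign.
exact: sign_end_sigma.
Qed.

Lemma sign_form_tauE e : is_sign e -> form_tau rho1 (sign_form e) = - e.
Proof.
move=> se; apply: (form_tauE (@ext_rho_clifford R m) (flip_vec_norm (Ordinal m_gt0))).
- exact: sign_form_neq0.
- by case: se => ->; rewrite ?opprK; [right|left].
exact: sign_form_tau.
Qed.

Lemma sign_form_iotaE e : form_iota (ext_even R m) (ext_odd R m) (sign_form e) = (-1) ^+ m.
Proof.
apply: (form_iotaE (@ext_grading R m)); [exact: sign_form_neq0 | exact: is_sign_exp|].
exact: sign_form_iota.
Qed.

Lemma sign_form_sigmaE e : is_sign e ->
  form_sigma (sign_form e) = (-1) ^+ (m * m.+1)./2 * adj_sign e.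
Proof.
move=> se; apply: form_sigmaE; first exact: sign_form_neq0.
  by apply: is_signM; [exact: is_sign_exp | exact: adj_sign_sign].
exact: sign_form_sigma.
Qed.

End SignForms.

(** * Tensor products of forms, and the map psi *)

Section TensorForms.
Variables (R : realType) (m : nat) (vol : ext R m).
Hypotheses (m_gt0 : (0 < m)%N) (volm : ext_deg m vol) (vol0 : vol != 0).
Variables (W2 S2 : vectType R) (rho2 : 'Hom(W2, 'End(S2))).
Local Notation S := {ffun {set 'I_m} -> S2}.
Local Notation rho := (tens_rho m rho2).
Local Notation E := (ext_E R m).
Local Notation sign_end := (@sign_end R m).
Local Notation sign_form := (sign_form vol).
Local Notation adj_sign := (@adj_sign R m).
Implicit Types (b : bilform S2) (A P : 'End(S2)).

Lemma tens_form_nondeg e b : nondegenerate b -> nondegenerate (tens_form (sign_form e) b).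
Proof.
move=> ndb x x0; apply/ffunP => A; rewrite [RHS]ffunE; apply: ndb => t.
have [s' [c c0 dual]] := sign_form_dual volm vol0 e A.
have := x0 (tens s' t); rewrite {1}[x]tens_basis_sum linear_sum sum_lfunE (bigD1 A) //=.
rewrite big1 => [|B BA]; last first.
  by rewrite tens_formE dual ffunE (negPf BA) mulr0 mul0r.
rewrite tens_formE dual ffunE eqxx mulr1 addr0 => /eqP.
by rewrite mulf_eq0 (negPf c0) => /eqP.
Qed.

Lemma tens_form_comp (b1 : bilform (ext R m)) b (A1 : 'End(ext R m)) A :
  (tens_form b1 b \o tens_end A1 A)%VF = tens_form (b1 \o A1)%VF (b \o A)%VF.
Proof.
apply: form_eqP => x y; move: x; apply: tens_ind => [x x' ex ex'|s t].
  by rewrite !formDl ex ex'.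
move: y; apply: tens_ind => [y y' ey ey'|s' t']; first by rewrite !formDr ey ey'.
by rewrite form_compE tens_endE !tens_formE !form_compE.
Qed.

(** The vectors of V_2 act through E on the first factor, and f and f_E move E
    across with the sign (-1)^m; so if tau(b_1) = (-1)^m tau(b) for b_1 = f or
    f_E, then the tensor product has tau = tau(b_1). *)
Lemma tens_form_tau e d b : is_sign e -> form_tau_eq rho2 b d -> (-1) ^+ m * d = - e ->
  form_tau_eq rho (tens_form (sign_form e) b) (- e).
Proof.
move=> se tb md v x y; move: x; apply: tens_ind => [x x' ex ex'|s t].
  by rewrite [rho v (_ + _)]linearD /= !formDl ex ex' mulrDr.
move: y; apply: tens_ind => [y y' ey ey'|s' t'].
  by rewrite [rho v (_ + _)]linearD /= !formDr ey ey' mulrDr.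
rewrite !tens_rhoE !formDl !formDr !tens_formE mulrDr; congr (_ + _).
  by rewrite sign_form_tau // mulrA.
by rewrite sign_form_E // tb -md; ring.
Qed.

Lemma tens_form_sigma (b1 : bilform (ext R m)) b c d :
  form_sigma_eq b1 c -> form_sigma_eq b d -> form_sigma_eq (tens_form b1 b) (c * d).
Proof.
move=> s1 s2 x y; move: x; apply: tens_ind => [x x' ex ex'|s t].
  by rewrite !formDl !formDr ex ex' mulrDr.
move: y; apply: tens_ind => [y y' ey ey'|s' t'].
  by rewrite !formDl !formDr ey ey' mulrDr.
by rewrite !tens_formE s1 s2; ring.
Qed.

Lemma tens_form_iota (b1 : bilform (ext R m)) b P c d :
  form_iota_eq E b1 c -> form_iota_eq P b d ->
  form_iota_eq (tens_end E P) (tens_form b1 b) (c * d).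
Proof.
move=> s1 s2 x y; move: x; apply: tens_ind => [x x' ex ex'|s t].
  by rewrite [tens_end _ _ (_ + _)]linearD /= !formDl ex ex' mulrDr.
move: y; apply: tens_ind => [y y' ey ey'|s' t'].
  by rewrite [tens_end _ _ (_ + _)]linearD /= !formDr ey ey' mulrDr.
by rewrite !tens_endE !tens_formE s1 s2; ring.
Qed.

Lemma tens_end_neq0 e A : tens_end (sign_end e) A != 0 <-> A != 0.
Proof.
have z : tens_end (sign_end e) (0 : 'End(S2)) = 0.
  by apply: tens_lfunP => s t; rewrite tens_endE !zero_lfunE tens0r.
split; apply: contra => /eqP e0; apply/eqP; first by rewrite e0 z.
by apply: (@tens_sign_end_inj R m S2 e); rewrite e0 z.
Qed.

Lemma tens_end_sigma e c b A d : nondegenerate b -> is_sign e -> is_sign c ->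
  end_sigma_eq (tens_form (sign_form e) b) (tens_end (sign_end c) A) (adj_sign c * d) <->
  end_sigma_eq b A d.
Proof.
move=> ndb se sc; split=> [sA t t'|sA x y].
  have nz : sign_form (e * c) != 0 by exact: sign_form_neq0.
  have [s [s' n0]] := form_neq0 nz.
  have := sA (tens s t) (tens s' t'); rewrite !tens_endE !tens_formE.
  have -> : sign_form e s (sign_end c s') = adj_sign c * sign_form (e * c) s s'.
    rewrite -sign_form_comp // [in RHS]form_compE (sign_end_sigma volm vol0 e sc) mulrA.
    by rewrite is_sign_sqr ?mul1r //; exact: adj_sign_sign.
  rewrite -[sign_form e (sign_end c s) s']form_compE sign_form_comp // => e'.
  apply: (mulfI n0); rewrite e'.
  transitivity ((adj_sign c * adj_sign c) * (sign_form (e * c) s s' * (d * b t (A t')))).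
    by ring.
  by rewrite is_sign_sqr ?mul1r //; exact: adj_sign_sign.
move: x; apply: tens_ind => [x x' ex ex'|s t].
  by rewrite [tens_end _ _ (_ + _)]linearD /= !formDl ex ex' mulrDr.
move: y; apply: tens_ind => [y y' ey ey'|s' t'].
  by rewrite [tens_end _ _ (_ + _)]linearD /= !formDr ey ey' mulrDr.
by rewrite !tens_endE !tens_formE (sign_end_sigma volm vol0 e sc) sA; ring.
Qed.

Lemma tens_end_iota e A P i :
  end_iota_eq (tens_end E P) (tens_end (sign_end e) A) i <-> end_iota_eq P A i.
Proof.
split=> [iA t|iA x].
  have := iA (tens (ffbasis R set0) t); rewrite !tens_endE sign_end_E sign_end0.
  rewrite (ext_E_basis R set0) cards0 scale1r => /ffunP/(_ set0).
  by rewrite [RHS]ffunE !tens_basisE eqxx !scale1r.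
move: x; apply: tens_ind => [x x' ex ex'|s t].
  by rewrite !linearD /= ex ex'.
by rewrite !tens_endE iA tensZr sign_end_E.
Qed.

Variables (S2p S2m : {vspace S2}) (P2 : 'End(S2)).
Hypothesis gP : cl0_reducible rho2 -> grading S2p S2m P2.
Hypothesis redE : cl0_reducible rho2 <-> cl0_reducible rho.

(** Tensoring with Id or E preserves and reflects admissibility. *)
Lemma tens_adm_end e c b A : nondegenerate b -> is_sign e -> is_sign c ->
  end_tau_eq rho2 A c ->
  adm_end rho (tens_even m S2p S2m) (tens_odd m S2p S2m)
    (tens_form (sign_form e) b) (tens_end (sign_end c) A) <->
  adm_end rho2 S2p S2m b A.
Proof.
move=> ndb se sc tA.
have sE := exists_sign_scale (adj_sign_sign m c) (fun d _ => tens_end_sigma A d ndb se sc).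
have iE : cl0_reducible rho2 -> let T := tens_end (sign_end c) A in
    (end_even (tens_even m S2p S2m) (tens_odd m S2p S2m) T \/
     end_odd (tens_even m S2p S2m) (tens_odd m S2p S2m) T) <->
    (end_even S2p S2m A \/ end_odd S2p S2m A).
  move=> /gP g2 T; have g := tens_grading m g2.
  rewrite (exists_signE (end_evenE g T) (end_oddE g T)).
  rewrite (exists_signE (end_evenE g2 A) (end_oddE g2 A)).
  by split=> -[i si iA]; exists i => //;
    [exact: (tens_end_iota _ _ _ _).1 iA | exact: (tens_end_iota _ _ _ _).2 iA].
split=> -[n t /sE s r]; split=> //.
- exact/(@tens_end_neq0 c).
- by exists c.
- by move=> red; apply/(iE red)/r/redE.
- exact/tens_end_neq0.
- by exists c => //; apply/tens_end_tau.
by move=> red; apply/iE; [exact/redE | apply/r/redE].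
Qed.

End TensorForms.

Section Psi.
Variables (R : realType) (m : nat) (W2 S2 : vectType R) (rho2 : 'Hom(W2, 'End(S2))).
Variables (g : W2 -> W2 -> R) (w : W2).
Hypotheses (cl : clifford_module g rho2) (gw : g w w != 0).
Local Notation S := {ffun {set 'I_m} -> S2}.
Local Notation rho := (tens_rho m rho2).
Local Notation tw := (twist rho2 g w).
Implicit Types (A B : 'End(S2)).

(** The map A |-> Id (x) A_+ + E (x) A_-, where A = A_+ + A_- is the splitting by
    the twist; A_+ commutes and A_- anticommutes with vectors when A lies in the
    Schur algebra. *)
Definition psi : 'Hom('End(S2), 'End(S)) := linfun (fun A =>
  tens_end \1 (2^-1 *: (A + tw A)) + tens_end (ext_E R m) (2^-1 *: (A - tw A)))%VF.

Lemma tens_endD (F : 'End(ext R m)) A B :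
  tens_end F (A + B)%R = tens_end F A + tens_end F B.
Proof.
apply: tens_lfunP => s t; rewrite add_lfunE !tens_endE add_lfunE.
by have := tens_linearr (F s) 1 (A t) (B t); rewrite !scale1r.
Qed.

Lemma twist_linear : linear tw.
Proof.
move=> c A B; apply/lfunP => s; rewrite add_lfunE scale_lfunE !twistE.
by rewrite add_lfunE scale_lfunE linearD linearZ /= scalerDr !scalerA mulrC.
Qed.

Lemma psiE A : psi A =
  tens_end \1 (2^-1 *: (A + tw A)) + tens_end (ext_E R m) (2^-1 *: (A - tw A)).
Proof.
apply: linfunE => c X Y; rewrite twist_linear.
have -> : c *: X + Y + (c *: tw X + tw Y) = c *: (X + tw X) + (Y + tw Y).
  by rewrite scalerDr addrACA.
have -> : c *: X + Y - (c *: tw X + tw Y) = c *: (X - tw X) + (Y - tw Y).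
  by rewrite scalerBr opprD addrACA.
have half (F : 'End(ext R m)) (X' Y' : 'End(S2)) :
    tens_end F (2^-1 *: (c *: X' + Y')) =
    c *: tens_end F (2^-1 *: X') + tens_end F (2^-1 *: Y').
  by rewrite scalerDr scalerA mulrC -scalerA tens_endD tens_endZ.
by rewrite !half addrACA -scalerDr.
Qed.

Lemma psi_tau A e : is_sign e -> end_tau_eq rho2 A e -> psi A = tens_end (sign_end m e) A.
Proof.
move=> se tA; rewrite psiE (twist_tau cl gw se tA).
have tz (F : 'End(ext R m)) : tens_end F (0 : 'End(S2)) = 0.
  by apply: tens_lfunP => s t; rewrite tens_endE !zero_lfunE tens0r.
have h2 : 2^-1 *: (A + A) = A.
  by rewrite -mulr2n -scaler_nat scalerA mulVf ?scale1r // pnatr_eq0.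
case: se => ->; rewrite ?scale1r ?scaleN1r ?opprK subrr h2 scaler0 tz ?addr0 ?add0r.
  by rewrite sign_end1.
by rewrite sign_endN1.
Qed.

(** E fixes e_A for the empty set A, so psi A acts on that line as A; this
    gives the injectivity of psi. *)
Lemma psi_basis A t : psi A (tens (ffbasis R set0) t) = tens (ffbasis R set0) (A t).
Proof.
rewrite psiE add_lfunE !tens_endE id_lfunE (ext_E_basis R set0) cards0 scale1r.
have := tens_linearr (ffbasis R (set0 : {set 'I_m})) 1 ((2^-1 *: (A + tw A)) t) ((2^-1 *: (A - tw A)) t).
by rewrite !scale1r => <-; rewrite -add_lfunE -half_sum.
Qed.

Lemma psi_inj A B : psi A = psi B -> A = B.
Proof.
move=> e; apply/lfunP => t; have := congr1 (fun F : 'End(S) => F (tens (ffbasis R set0) t)) e.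
by rewrite !psi_basis => /ffunP/(_ set0); rewrite !tens_basisE eqxx !scale1r.
Qed.

Lemma schurD (W' S' : vectType R) (r : 'Hom(W', 'End(S'))) (X Y : 'End(S')) :
  schur r X -> schur r Y -> schur r (X + Y).
Proof. by move=> sX sY u v; rewrite comp_lfunDl comp_lfunDr sX sY. Qed.

Lemma psi_schur A : schur rho2 A -> schur rho (psi A).
Proof.
move=> sA; have [t1 tN] := twist_split cl gw sA.
have clS := @tens_rho_clifford R m W2 S2 rho2 g cl.
rewrite [A](half_sum A (tw A)) linearD /=; apply: schurD.
  rewrite (psi_tau (or_introl erefl) t1).
  apply: (end_tau_schur clS (e := 1)); first by left.
  by apply/tens_end_tau => //; left.
rewrite (psi_tau (or_intror erefl) tN).
apply: (end_tau_schur clS (e := -1)); first by right.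
by apply/tens_end_tau => //; right.
Qed.

Lemma orthogonal_sum_anisotropic :
  orthogonal_sum (@neutral_form R m) g (0, w) (0, w) != 0.
Proof.
rewrite /orthogonal_sum /= /neutral_form big1 ?add0r // => i _.
by rewrite mxE mul0r addr0.
Qed.

Lemma psi_surj Z : schur rho Z -> exists2 A, schur rho2 A & psi A = Z.
Proof.
move=> sZ; have clS := @tens_rho_clifford R m W2 S2 rho2 g cl.
have [t1 tN] := twist_split clS orthogonal_sum_anisotropic sZ.
have [A1 e1 a1] := tens_end_tau_inv (or_introl erefl) t1.
have [A2 e2 a2] := tens_end_tau_inv (or_intror erefl) tN.
exists (A1 + A2).
  apply: schurD; [apply: (end_tau_schur cl _ a1) | apply: (end_tau_schur cl _ a2)].
    by left.
  by right.
rewrite linearD /= (psi_tau (or_introl erefl) a1) (psi_tau (or_intror erefl) a2).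
rewrite -e1 -e2; exact/esym/half_sum.
Qed.

Lemma psi1 : psi \1%VF = \1%VF.
Proof.
have t1 : end_tau_eq rho2 \1%VF 1.
  by apply/end_tau_eqP => v s; rewrite !id_lfunE scale1r.
rewrite (psi_tau (or_introl erefl) t1) sign_end1.
by apply: tens_lfunP => s t; rewrite tens_endE !id_lfunE.
Qed.

Lemma psiM_tau A B e c : is_sign e -> is_sign c ->
  end_tau_eq rho2 A e -> end_tau_eq rho2 B c ->
  psi (A \o B)%VF = (psi A \o psi B)%VF.
Proof.
move=> se sc tA tB; rewrite (psi_tau se tA) (psi_tau sc tB) tens_end_comp sign_endM //.
apply: psi_tau; first exact: is_signM.
move: tA tB => /end_tau_eqP tA /end_tau_eqP tB; apply/end_tau_eqP => v s.
by rewrite !comp_lfunE tB linearZ /= tA scalerA mulrC.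
Qed.

Lemma psiM A B : schur rho2 A -> schur rho2 B -> psi (A \o B)%VF = (psi A \o psi B)%VF.
Proof.
move=> sA sB; have [s1 sN] : is_sign (1 : R) /\ is_sign (-1 : R) by split; [left|right].
have [a1 aN] := twist_split cl gw sA; have [b1 bN] := twist_split cl gw sB.
rewrite [A](half_sum A (tw A)) [B](half_sum B (tw B)).
move: a1 aN b1 bN; set A1 := _ *: (A + _); set A2 := _ *: (A - _).
set B1 := _ *: (B + _); set B2 := _ *: (B - _) => a1 aN b1 bN.
rewrite [psi (A1 + A2)]linearD [psi (B1 + B2)]linearD /=.
rewrite !(comp_lfunDl, comp_lfunDr) !linearD /=.
by rewrite (psiM_tau s1 s1 a1 b1) (psiM_tau s1 sN a1 bN) (psiM_tau sN s1 aN b1) (psiM_tau sN sN aN bN).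
Qed.

End Psi.

(** * Companions, invariants and periodicity *)

Lemma half_mod4 m : (4 %| m)%N -> odd m = false /\ odd (m * m.+1)./2 = false.
Proof.
move=> /dvdnP[q ->]; split; first by rewrite oddM andbF.
have -> : (q * 4 * (q * 4).+1 = (q * (q * 4).+1).*2.*2)%N by rewrite -!mul2n; nia.
by rewrite doubleK odd_double.
Qed.

Section PeriodicityFour.
Variables (R : realType) (m : nat) (vol : ext R m).
Hypotheses (volm : ext_deg m vol) (vol0 : vol != 0).
Variables (W2 S2 : vectType R) (rho2 : 'Hom(W2, 'End(S2))).
Hypothesis m4 : (4 %| m)%N.

Lemma adj_sign_mod4 (e : R) : adj_sign m e = 1.
Proof.
have [oddm _] := half_mod4 m4.
by rewrite /adj_sign -signr_odd oddm; case: ifP.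
Qed.

Lemma companion_form_mod4 (b2 : bilform S2) b1 : companion_form rho2 vol b2 b1 ->
  form_iota (ext_even R m) (ext_odd R m) b1 = 1 /\ form_sigma b1 = 1.
Proof.
have [oddm oddh] := half_mod4 m4.
move=> [/sign_formP[e se ->] _]; rewrite sign_form_iotaE // sign_form_sigmaE //.
by rewrite -(signr_odd _ m) oddm -(signr_odd _ (m * m.+1)./2) oddh adj_sign_mod4 mulr1.
Qed.

Lemma companion_end_mod4 (A2 : 'End(S2)) A1 e : companion_end rho2 A2 A1 ->
  end_iota (ext_even R m) (ext_odd R m) A1 = 1 /\ end_sigma (sign_form vol e) A1 = 1.
Proof.
move=> [A1E _].
have [c sc ->] : exists2 c : R, is_sign c & A1 = sign_end m c.
  by case: A1E => ->; [exists 1; [left|rewrite sign_end1] | exists (-1); [right|rewrite sign_endN1]].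
by rewrite sign_end_iotaE sign_end_sigmaE // adj_sign_mod4.
Qed.

End PeriodicityFour.

Section Companions.
Variables (R : realType) (m : nat) (vol : ext R m).
Hypotheses (m_gt0 : (0 < m)%N) (volm : ext_deg m vol) (vol0 : vol != 0).
Variables (W2 S2 : vectType R) (rho2 : 'Hom(W2, 'End(S2))).
Variables (g : W2 -> W2 -> R) (w : W2).
Hypotheses (cl : clifford_module g rho2) (gw : g w w != 0).

(** The hypothesis tau(A_2) = iota(A_1) tau(A_1) selects Id or E, since iota = 1
    for both and tau = 1, -1. *)
Lemma companion_endE (A2 : 'End(S2)) e A1 : A2 != 0 -> is_sign e ->
  end_tau_eq rho2 A2 e -> companion_end rho2 A2 A1 <-> A1 = sign_end m e.
Proof.
move=> A0 se tA; rewrite /companion_end (end_tauE cl gw A0 se tA).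
split=> [[A1E]|->].
  have [c sc ->] : exists2 c, is_sign c & A1 = sign_end m c.
    by case: A1E => ->; [exists 1; [left|rewrite sign_end1] | exists (-1); [right|rewrite sign_endN1]].
  by rewrite sign_end_iotaE sign_end_tauE // mul1r => ->.
split; last by rewrite sign_end_iotaE sign_end_tauE // mul1r.
by case: se => ->; [left; rewrite sign_end1 | right; rewrite sign_endN1].
Qed.

(** Since tau(f) = -1, tau(f_E) = 1 and iota = (-1)^m for both, the companion
    form has tau = (-1)^m tau(b_2). *)
Lemma companion_formE (b2 : bilform S2) d b1 : b2 != 0 -> is_sign d ->
  form_tau_eq rho2 b2 d ->
  companion_form rho2 vol b2 b1 <-> b1 = sign_form vol (- ((-1) ^+ m * d)).
Proof.
move=> b0 sd tb; rewrite /companion_form (form_tauE cl gw b0 sd tb) sign_formP.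
have sm := is_sign_exp R m.
have se : is_sign (- ((-1) ^+ m * d)).
  by rewrite -mulN1r; apply: is_signM; [right | apply: is_signM].
split=> [[[c sc ->]]|->].
  by rewrite sign_form_iotaE // sign_form_tauE // => ->; rewrite sign_mulI // opprK.
split; first by exists (- ((-1) ^+ m * d)).
by rewrite sign_form_iotaE // sign_form_tauE // opprK sign_mulI.
Qed.

End Companions.

Section Invariants.
Variables (R : realType) (m : nat) (vol : ext R m).
Hypotheses (m_gt0 : (0 < m)%N) (volm : ext_deg m vol) (vol0 : vol != 0).
Variables (W2 S2 : vectType R) (rho2 : 'Hom(W2, 'End(S2))).
Variables (g : W2 -> W2 -> R) (w : W2).
Hypotheses (cl : clifford_module g rho2) (gw : g w w != 0).
Variables (S2p S2m : {vspace S2}) (P2 : 'End(S2)).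
Hypothesis gP : cl0_reducible rho2 -> grading S2p S2m P2.
Local Notation rho := (tens_rho m rho2).
Local Notation rho1 := (ext_rho R m).
Local Notation Sp := (tens_even m S2p S2m).
Local Notation Sm := (tens_odd m S2p S2m).
Local Notation S1p := (ext_even R m).
Local Notation S1m := (ext_odd R m).

Let clS := @tens_rho_clifford R m W2 S2 rho2 g cl.
Let gS := orthogonal_sum_anisotropic m gw.

Lemma tens_form_invariants (b2 : bilform S2) b1 : adm_form rho2 S2p S2m b2 ->
  companion_form rho2 vol b2 b1 -> tens_form b1 b2 != 0 ->
  [/\ form_tau rho (tens_form b1 b2) = form_tau rho1 b1,
    form_tau rho1 b1 = form_iota S1p S1m b1 * form_tau rho2 b2,
    form_sigma (tens_form b1 b2) = form_sigma b1 * form_sigma b2 &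
    cl0_reducible rho2 -> form_iota Sp Sm (tens_form b1 b2) =
      form_iota S1p S1m b1 * form_iota S2p S2m b2].
Proof.
case=> b0 [d sd tb] [c sc sb] ib comp n0.
have sm := is_sign_exp R m.
have [_ comp2] := comp.
move: comp => /(companion_formE m_gt0 volm vol0 cl gw _ b0 sd tb).
set e := - _ => b1E.
have se : is_sign e.
  by rewrite /e -mulN1r; apply: is_signM; [right | apply: is_signM].
have md : (-1) ^+ m * d = - e by rewrite /e opprK.
split.
- rewrite b1E sign_form_tauE //.
  apply: (form_tauE clS gS); [by rewrite -b1E | |].
    by case: (se) => ->; rewrite ?opprK; [right|left].
  exact: tens_form_tau tb md.
- rewrite comp2 sign_mulI // b1E sign_form_iotaE //; exact: sm.
- rewrite b1E sign_form_sigmaE // (form_sigmaE b0 sc sb).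
  apply: form_sigmaE; first by rewrite -b1E.
    by apply: is_signM => //; apply: is_signM; [exact: is_sign_exp | exact: adj_sign_sign].
  by apply: tens_form_sigma => //; exact: sign_form_sigma.
move=> red; have g2 := gP red.
have /(exists_signE (form_orthogonalE g2 b2) (form_isotropicE g2 b2)) [i si ii] := ib red.
rewrite b1E sign_form_iotaE // (form_iotaE g2 b0 si ii).
apply: (form_iotaE (tens_grading m g2)); first by rewrite -b1E.
  exact: is_signM.
by apply: tens_form_iota => //; exact: sign_form_iota.
Qed.

Lemma tens_end_invariants (h2 : bilform S2) e (A2 : 'End(S2)) A1 : is_sign e ->
  nondegenerate h2 -> adm_end rho2 S2p S2m h2 A2 -> companion_end rho2 A2 A1 ->
  [/\ end_tau rho (tens_end A1 A2) = end_tau rho1 A1,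
    end_tau rho1 A1 = end_iota S1p S1m A1 * end_tau rho2 A2,
    end_sigma (tens_form (sign_form vol e) h2) (tens_end A1 A2) =
      end_sigma (sign_form vol e) A1 * end_sigma h2 A2 &
    cl0_reducible rho2 -> end_iota Sp Sm (tens_end A1 A2) =
      end_iota S1p S1m A1 * end_iota S2p S2m A2].
Proof.
move=> se ndh [A0 [c sc tA] [d sd sA] iA] comp.
have /(companion_endE m_gt0 cl gw _ A0 sc tA) A1E := comp.
have [_ ->] := comp; rewrite A1E sign_end_iotaE !mul1r sign_end_tauE //.
have n0 : tens_end (sign_end m c) A2 != 0 by apply/tens_end_neq0.
split=> //.
- apply: (end_tauE clS gS) => //; exact/tens_end_tau.
- rewrite sign_end_sigmaE // (end_sigmaE ndh A0 sd sA).
  apply: end_sigmaE => //; first exact: tens_form_nondeg.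
    by apply: is_signM => //; exact: adj_sign_sign.
  exact/tens_end_sigma.
move=> red; have g2 := gP red.
have /(exists_signE (end_evenE g2 A2) (end_oddE g2 A2)) [i si ii] := iA red.
rewrite (end_iotaE g2 A0 si ii).
apply: (end_iotaE (tens_grading m g2)) => //; exact/tens_end_iota.
Qed.

End Invariants.

From mathcomp Require Import classical_sets functions.
Local Open Scope classical_set_scope.

Theorem theorem6p1 (R : realType) (m k : nat) (neg : bool)
  (vol : ext R m) (S2 : vectType R) (rho2 : 'Hom('rV[R]_k, 'End(S2)))
  (S2p S2m : {vspace S2}) (h2 : bilform S2) (h1 : bilform (ext R m)) :
  (1 <= m)%N -> (1 <= k)%N ->
  ext_deg m vol -> vol != 0 ->
  spinor_module (definite_form neg) rho2 ->
  (cl0_reducible rho2 -> semispinors rho2 S2p S2m) ->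
  invariant_scalar_product (definite_form neg) rho2 h2 ->
  companion_form rho2 vol h2 h1 ->
  let rho1 := ext_rho R m in
  let S1p := ext_even R m in
  let S1m := ext_odd R m in
  let rho := tens_rho m rho2 in
  let Sp := tens_even m S2p S2m in
  let Sm := tens_odd m S2p S2m in
  let h := tens_form h1 h2 in
  let B2 := inv_forms rho2 in
  let B := inv_forms rho in
  let C2 := schur rho2 in
  let C := schur rho in
  let AB2 := B2 `&` adm_form rho2 S2p S2m in
  let AB := B `&` adm_form rho Sp Sm in
  let AC2 := C2 `&` adm_end rho2 S2p S2m h2 in
  let AC := C `&` adm_end rho Sp Sm h in
  [/\ cl0_reducible rho2 <-> cl0_reducible rho,
    (forall b2, AB2 b2 -> exists! b1 : bilform (ext R m), companion_form rho2 vol b2 b1) /\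
    (forall A2, AC2 A2 -> exists! A1 : 'End(ext R m), companion_end rho2 A2 A1),
    exists phi : 'Hom(bilform S2, bilform {ffun {set 'I_m} -> S2}),
      let phi_rule (f : 'Hom(bilform S2, bilform {ffun {set 'I_m} -> S2})) :=
        forall b2 b1, AB2 b2 -> companion_form rho2 vol b2 b1 ->
          f b2 = tens_form b1 b2 in
      [/\ set_bij B2 B phi,
        phi @` AB2 = AB,
        phi_rule phi,
        (forall f, phi_rule f -> forall b, B2 b -> f b = phi b) &
        (forall b2 b1, AB2 b2 -> companion_form rho2 vol b2 b1 ->
          [/\ form_tau rho (phi b2) = form_tau rho1 b1,
            form_tau rho1 b1 = form_iota S1p S1m b1 * form_tau rho2 b2,
            form_sigma (phi b2) = form_sigma b1 * form_sigma b2 &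
            cl0_reducible rho2 ->
              form_iota Sp Sm (phi b2) =
                form_iota S1p S1m b1 * form_iota S2p S2m b2]) /\
        ((4 %| m)%N -> forall b2, AB2 b2 ->
          [/\ form_tau rho (phi b2) = form_tau rho2 b2,
            form_sigma (phi b2) = form_sigma b2 &
            cl0_reducible rho2 ->
              form_iota Sp Sm (phi b2) = form_iota S2p S2m b2])] &
    exists psi : 'Hom('End(S2), 'End({ffun {set 'I_m} -> S2})),
      let psi_rule (f : 'Hom('End(S2), 'End({ffun {set 'I_m} -> S2}))) :=
        forall A2 A1, AC2 A2 -> companion_end rho2 A2 A1 ->
          f A2 = tens_end A1 A2 in
      [/\ [/\ set_bij C2 C psi, psi \1%VF = \1%VF &
            forall X Y, C2 X -> C2 Y -> psi (X \o Y)%VF = (psi X \o psi Y)%VF],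
        psi @` AC2 = AC,
        psi_rule psi,
        (forall f, psi_rule f -> forall A, C2 A -> f A = psi A) &
        (forall A2 A1, AC2 A2 -> companion_end rho2 A2 A1 ->
          [/\ end_tau rho (psi A2) = end_tau rho1 A1,
            end_tau rho1 A1 = end_iota S1p S1m A1 * end_tau rho2 A2,
            end_sigma h (psi A2) = end_sigma h1 A1 * end_sigma h2 A2 &
            cl0_reducible rho2 ->
              end_iota Sp Sm (psi A2) =
                end_iota S1p S1m A1 * end_iota S2p S2m A2]) /\
        ((4 %| m)%N -> forall A2, AC2 A2 ->
          [/\ end_tau rho (psi A2) = end_tau rho2 A2,
            end_sigma h (psi A2) = end_sigma h2 A2 &
            cl0_reducible rho2 ->
              end_iota Sp Sm (psi A2) = end_iota S2p S2m A2])]].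
Proof.
move=> m_gt0 k_gt0 volm vol0 [cl irr] ss ih ch rho1 S1p S1m rho Sp Sm h B2 B C2 C AB2 AB AC2 AC.
have [hsym hpos _] := ih.
have gw : definite_form neg (delta_mx 0 (Ordinal k_gt0)) (delta_mx 0 (Ordinal k_gt0)) != 0 :> R.
  by rewrite definite_delta signr_eq0.
set w := delta_mx 0 (Ordinal k_gt0) in gw.
(* h_2 has tau = d, since unit vectors act as isometries with square -+ 1. *)
have th2 := scalar_product_tau cl ih; set d := - _ in th2.
have sd : is_sign d by rewrite /d; case: (neg); rewrite ?opprK; [left|right].
have sh2 : form_sigma_eq h2 1 by move=> s t; rewrite mul1r.
have nd2 : nondegenerate h2 by exact: scalar_product_nondeg hpos.
have [full0 _ _] := irr.
have h20 : h2 != 0.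
  have v0 : vpick (fullv : {vspace S2}) != 0 by rewrite vpick0.
  by apply: contraTneq (hpos _ v0) => ->; rewrite !zero_lfunE ltxx.
have redE := @tens_cl0_reducible R m _ S2 rho2 _ cl _ gw S2p S2m ss.
have [P2 gP] : exists P2 : 'End(S2), cl0_reducible rho2 -> [/\ grading S2p S2m P2,
    forall v s, P2 (rho2 v s) = - rho2 v (P2 s) & form_iota_eq P2 h2 1].
  (* The operator 0 stands for no grading when S2 is irreducible over Cl^0. *)
  have [red|nred] := pselect (cl0_reducible rho2); last by exists 0.
  have [P gP aP] := semispinors_grading (ss red); have [PP _ _] := gP.
  by exists P => _; split=> //; exact: anti_involution_isometry irr PP aP.
have gr2 : cl0_reducible rho2 -> grading S2p S2m P2 by case/gP.
have /(companion_formE m_gt0 volm vol0 cl gw _ h20 sd th2) := ch.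
(* h_1 is f for e1 = 1 and f_E for e1 = -1, and tau(h_1) = - e1. *)
set e1 := - _ => h1E.
have se1 : is_sign e1.
  rewrite /e1 -mulN1r; apply: is_signM; [by right | apply: is_signM => //].
  exact: is_sign_exp.
have md : (-1) ^+ m * d = - e1 by rewrite /e1 opprK.
have hE : h = tens_form (sign_form vol e1) h2 by rewrite /h h1E.
have ndh : nondegenerate h by rewrite hE; exact: tens_form_nondeg.
have sN1 : is_sign (- e1) by case: se1 => ->; rewrite ?opprK; [right|left].
have th : form_tau_eq rho h (- e1) by rewrite hE; exact: tens_form_tau th2 md.
have [sg [ssg sgh]] : exists c, is_sign c /\ form_sigma_eq h c.
  exists ((-1) ^+ (m * m.+1)./2 * adj_sign m e1 * 1); split.
    by rewrite mulr1; apply: is_signM; [exact: is_sign_exp | exact: adj_sign_sign].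
  by rewrite hE; apply: tens_form_sigma => //; exact: sign_form_sigma.
have gr : cl0_reducible rho -> grading Sp Sm (tens_end (ext_E R m) P2) /\
    form_iota_eq (tens_end (ext_E R m) P2) h ((-1) ^+ m * 1).
  move=> /redE /gP[g2 _ i2]; split; first exact: tens_grading.
  by rewrite hE; apply: tens_form_iota => //; exact: sign_form_iota.
have s1 : is_sign (1 : R) by left.
have clS := @tens_rho_clifford R m _ S2 rho2 _ cl.
have B2E A : B2 (h2 \o A)%VF <-> C2 A := inv_forms_comp A nd2 sd th2.
have BE Z : B (h \o Z)%VF <-> C Z := inv_forms_comp Z ndh sN1 th.
have adm2 A : adm_form rho2 S2p S2m (h2 \o A)%VF <-> adm_end rho2 S2p S2m h2 A.
  apply: (adm_form_comp (P := P2) (i := 1) _ nd2 sd s1 s1 th2 sh2).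
  by move=> red; have [] := gP red.
have adm Z : adm_form rho Sp Sm (h \o Z)%VF <-> adm_end rho Sp Sm h Z.
  apply: (adm_form_comp _ ndh sN1 ssg _ th sgh gr).
  by rewrite mulr1; exact: is_sign_exp.
pose ps := psi m rho2 (definite_form neg) w.
have admps A : adm_end rho Sp Sm h (ps A) <-> adm_end rho2 S2p S2m h2 A.
  split=> [aZ|aA].
    have [_ [c sc tZ] _ _] := aZ.
    have [A2 ZE tA] := tens_end_tau_inv sc tZ.
    have eA : A = A2.
      by apply: (@psi_inj R m _ S2 rho2 (definite_form neg) w); rewrite (psi_tau m cl gw sc tA).
    move: aZ; rewrite ZE hE eA.
    by move/(tens_adm_end volm vol0 gr2 redE nd2 se1 sc tA).
  have [_ [c sc tA] _ _] := aA.
  rewrite /ps (psi_tau m cl gw sc tA) hE.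
  exact/(tens_adm_end volm vol0 gr2 redE nd2 se1 sc tA).
have ps_schur A : C2 A -> C (ps A) := psi_schur cl gw (A:=A).
have ps_surj Z : C Z -> exists2 A, C2 A & ps A = Z := psi_surj cl gw (Z:=Z).
have ps_inj A A' : ps A = ps A' -> A = A' := @psi_inj R m _ S2 rho2 (definite_form neg) w A A'.
have compF b2 : AB2 b2 -> exists! b1 : bilform (ext R m), companion_form rho2 vol b2 b1.
  move=> [_ [b0 [c sc tb] _ _]].
  exists (sign_form vol (- ((-1) ^+ m * c))); split.
    by apply/(companion_formE m_gt0 volm vol0 cl gw _ b0 sc tb).
  by move=> b1 /(companion_formE m_gt0 volm vol0 cl gw _ b0 sc tb) ->.
have compE A2 : AC2 A2 -> exists! A1 : 'End(ext R m), companion_end rho2 A2 A1.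
  move=> [_ [A0 [c sc tA] _ _]].
  exists (sign_end m c); split; first exact/(companion_endE m_gt0 cl gw _ A0 sc tA).
  by move=> A1 /(companion_endE m_gt0 cl gw _ A0 sc tA) ->.
have span := schur_admissible_ind hsym hpos th2 gP cl gw.
have compT (b : bilform S2) : exists2 A, b = (h2 \o A)%VF & (h2^-1 \o b)%VF = A.
  by exists (h2^-1 \o b)%VF => //; rewrite (nondeg_compVK nd2).
split=> //.
- (* phi is psi conjugated by the bijections A |-> h_2(A -, -), Z |-> h(Z -, -). *)
  pose phi0 (b : bilform S2) : bilform {ffun {set 'I_m} -> S2} := (h \o ps (h2^-1 \o b))%VF.
  have phi0_lin : linear phi0.
    move=> c b b'; rewrite /phi0 comp_lfunDr -comp_lfunZr linearD linearZ /=.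
    by rewrite comp_lfunDr -comp_lfunZr.
  pose phi := linfun phi0.
  have phiE A : phi (h2 \o A)%VF = (h \o ps A)%VF.
    by rewrite linfunE // /phi0 nondeg_compK.
  have ruleE b2 b1 : AB2 b2 -> companion_form rho2 vol b2 b1 -> phi b2 = tens_form b1 b2.
    have [A -> _] := compT b2; rewrite phiE.
    move=> [_ ab] comp; have [A0 [c sc tA] _ _] := (adm2 A).1 ab.
    have tb : form_tau_eq rho2 (h2 \o A)%VF (d * c) by apply/form_tau_comp.
    have b0 : (h2 \o A)%VF != 0 by apply/nondeg_comp_neq0.
    move: comp => /(companion_formE m_gt0 volm vol0 cl gw _ b0 (is_signM sd sc) tb) ->.
    by rewrite mulrA md mulNr opprK hE /ps (psi_tau m cl gw sc tA) tens_form_comp sign_form_comp.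
  have phi_adm A : AC2 A -> AB (phi (h2 \o A)%VF).
    by move=> [sA aA]; rewrite phiE; split; [apply/BE/ps_schur | apply/adm/admps].
  have phi_neq0 b2 : AB2 b2 -> phi b2 != 0.
    have [A -> _] := compT b2; move=> [/B2E sA /adm2 aA].
    by have [_ []] := phi_adm A (conj sA aA).
  exists phi; split.
  + split.
    * by move=> b; have [A -> _] := compT b; rewrite phiE => /B2E /ps_schur sA; apply/BE.
    * move=> b b' _ _; have [A -> _] := compT b; have [A' -> _] := compT b'.
      rewrite !phiE => /(congr1 (fun c => h^-1 \o c)%VF).
      by rewrite !(nondeg_compK ndh) => /ps_inj ->.
    move=> b bB; have bE := nondeg_compVK ndh b; rewrite -bE in bB.
    have [A sA AE] := ps_surj _ ((BE _).1 bB).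
    exists (h2 \o A)%VF; first exact/B2E.
    by rewrite phiE AE bE.
  + apply/seteqP; split=> b.
      move=> [b2 ab2 <-]; have [A bE _] := compT b2; rewrite bE.
      by apply: phi_adm; move: ab2; rewrite bE => -[/B2E sA /adm2 aA].
    have bE := nondeg_compVK ndh b; rewrite -bE => -[/BE sZ /adm aZ].
    have [A sA AE] := ps_surj _ sZ.
    exists (h2 \o A)%VF; last by rewrite phiE AE.
    split; first exact/B2E.
    by apply/adm2/admps; rewrite AE.
  + exact: ruleE.
  + (* Admissible endomorphisms span the Schur algebra. *)
    move=> f fE b; have [A -> _] := compT b; move=> /B2E.
    apply: (span (fun A => f (h2 \o A)%VF = phi (h2 \o A)%VF)) => [X Y eX eY||X sX aX].
    * by rewrite comp_lfunDr !linearD /= eX eY.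
    * by rewrite comp_lfun0r !linear0.
    have ab : AB2 (h2 \o X)%VF by split; [apply/B2E | apply/adm2].
    have [b1 [cb1 _]] := compF _ ab.
    by rewrite (fE _ _ ab cb1) (ruleE _ _ ab cb1).
  have inv b2 b1 (ab : AB2 b2) (cb : companion_form rho2 vol b2 b1) :=
    tens_form_invariants m_gt0 volm vol0 cl gw gr2 ab.2 cb.
  split=> [b2 b1 ab cb|m4 b2 ab].
    have eq := ruleE _ _ ab cb; rewrite eq; apply: inv => //.
    by rewrite -eq; exact: phi_neq0.
  have [b1 [cb _]] := compF _ ab; have eq := ruleE _ _ ab cb.
  have [|t1 t2 sE iE] := inv b2 b1 ab cb; first by rewrite -eq; exact: phi_neq0.
  have [i1 s1'] := companion_form_mod4 volm vol0 m4 cb.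
  rewrite eq t1 t2 sE i1 s1' !mul1r; split=> // red.
  by rewrite (iE red) i1 mul1r.
have psE A c : is_sign c -> end_tau_eq rho2 A c -> ps A = tens_end (sign_end m c) A.
  by move=> sc tA; rewrite /ps (psi_tau m cl gw sc tA).
have ruleE A2 A1 : AC2 A2 -> companion_end rho2 A2 A1 -> ps A2 = tens_end A1 A2.
  move=> [_ [A0 [c sc tA] _ _]] /(companion_endE m_gt0 cl gw _ A0 sc tA) ->.
  exact: psE.
exists ps; split.
- split; [split|exact: psi1|by move=> X Y sX sY; exact: psiM].
  + by move=> A; apply: ps_schur.
  + by move=> A A' _ _; apply: ps_inj.
  by move=> Z /ps_surj[A sA AE]; exists A.
- apply/seteqP; split=> Z.
    by move=> [A [sA aA] <-]; split; [exact: ps_schur | exact/admps].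
  move=> [/ps_surj[A sA <-] /admps aA]; by exists A.
- exact: ruleE.
- move=> f fE A; apply: (span (fun A => f A = ps A)) => [X Y eX eY||X sX aX].
  + by rewrite !linearD /= eX eY.
  + by rewrite !linear0.
  have aX' : AC2 X by [].
  have [A1 [cA _]] := compE _ aX'.
  by rewrite (fE _ _ aX' cA) (ruleE _ _ aX' cA).
have inv A2 A1 (aA : AC2 A2) (cA : companion_end rho2 A2 A1) :=
  tens_end_invariants m_gt0 volm vol0 cl gw gr2 se1 nd2 aA.2 cA.
split=> [A2 A1 aA cA|m4 A2 aA].
  by rewrite (ruleE _ _ aA cA) hE h1E; exact: inv.
have [A1 [cA _]] := compE _ aA.
have [t1 t2 sE iE] := inv _ _ aA cA.
have [i1 s1'] := companion_end_mod4 volm vol0 m4 e1 cA.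
rewrite (ruleE _ _ aA cA) hE t1 t2 sE i1 s1' !mul1r; split=> // red.
by rewrite (iE red) i1 mul1r.
Qed.
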